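(* Let $d\ge1$, $\lambda\in\{+1,-1\}$ and $\ell=0\in\mathbb{Z}^d$. Fix $\rho_0>0$ with $1+2\lambda\rho_0^2>0$, $h_0>0$ and an integer $N\ge2$. For every $\gamma>0$ there exists a subset $\mathcal{P}(\gamma)$ of $[0,\rho_0]\times[0,h_0]$ of Lebesgue measure $|\mathcal{P}(\gamma)|\ge\rho_0h_0-\gamma$ such that Assumptions 1 and 2 (for $\ell=0$) hold for all $(\rho,h)\in\mathcal{P}(\gamma)$ (with step-size $h>0$) and all integers $K\ge1$ that satisfy $$dhK^2+2h\rho_0^2\le\frac{\pi}{N+1},$$ with small parameter $\widehat\varepsilon=C_2h^2$ and constants $c_1=c_1(\rho_0)$, $C_2=C_2(\rho_0)$, $c_2=c_2(h_0,N,\gamma,\rho_0)$, $\delta_2=1$ and $s_2=5^4N^5$ (the arguments list the quantities on which the constants depend; in particular they are independent of $\rho$, $h$ and $K$).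
   Context: $|\cdot|$ is the Euclidean norm on $\mathbb{Z}^d$; $\mathcal{K}=\{-K,\dots,K-1\}^d$, $\mathcal{Z}=\mathcal{K}\setminus\{0\}$. The assumptions below are stated for $\ell=0$. The dimension $d$ and the sign $\lambda$ are fixed throughout. Assumption 1 (for $h>0$, $K$, $\rho\ge0$ with constant $c_1>0$): $\bigl(\cos(|j|^2h)-h\lambda\rho^2\sin(|j|^2h)\bigr)^2\le1-c_1h^2$ for all $j\in\mathcal{Z}$. Under Assumption 1 the frequencies are $$\omega_j=\frac{\arccos\bigl(\cos(|j|^2h)-h\lambda\rho^2\sin(|j|^2h)\bigr)}{h\,\mathrm{sgn}\bigl(\sin(|j|^2h)+h\lambda\rho^2\cos(|j|^2h)\bigr)},\quad j\in\mathcal{Z}.$$ Assumption 2 (for $h,K,\rho$, with $N\ge2$, a small parameter $\widehat\varepsilon$ and positive constants $c_2,\delta_2,s_2$): there exist real numbers $\varpi_j$, $j\in\mathcal{Z}$ (modified frequencies), such that: (a) $|\varpi_j-\omega_j|\le\widehat\varepsilon$ for all $j\in\mathcal{Z}$. (b) For all $(k_j)_{j\in\mathcal{Z}}\in\mathbb{Z}^{\mathcal{Z}}$ with $0<\sum_j|k_j|\le N+1$ and such that $k_j\ne0$ only if $k_l=0$ for all $l\ne j$ with $\varpi_l=\varpi_j$: if $\delta:=\bigl|\bigl(e^{i(\sum_{j}k_j\varpi_j)h}-1\bigr)/h\bigr|\le\delta_2$, then for all $l\in\mathcal{Z}$ with $k_l\ne0$, $$\frac{|l|^4}{\prod_{j\in\mathcal{Z}}|j|^{2|k_j|}}\le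 c_2\,\delta^{N/s_2}.$$ (c) If $(k_j)\in\mathbb{Z}^{\mathcal{Z}}$ with $\sum_j|k_j|\le N+1$ satisfies $h\sum_jk_j\varpi_j\in2\pi\mathbb{Z}$, then $\sum_{j\in\mathcal{Z},\,|j|^2=m}k_j=0$ for all $m\in\mathbb{Z}$. *)

(* Defs.v *)
From mathcomp Require Import all_boot all_order all_algebra.
From mathcomp Require Import all_classical all_reals all_analysis.
From mathcomp.real_closed Require Import complex.
Set Implicit Arguments.
Unset Strict Implicit.
Unset Printing Implicit Defensive.
Import Order.TTheory GRing.Theory Num.Theory.
Import numFieldNormedType.Exports.
Local Open Scope ring_scope.

(* {-K, ..., K-1}^d, with each coordinate stored shifted by K *)
Definition box (d K : nat) : predArgType := {ffun 'I_d -> 'I_(K.*2)}.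

Definition box_pt (d K : nat) (j : box d K) : 'rV[int]_d :=
  \row_i ((j i : nat)%:Z - K%:Z).

Definition mode (d K : nat) : predArgType := {j : box d K | box_pt j != 0}.

Definition mode_pt (d K : nat) (j : mode d K) : 'rV[int]_d := box_pt (val j).

Section Assumptions.
Variable R : realType.

Definition enorm (d : nat) (v : 'rV[int]_d) : R :=
  Num.sqrt (\sum_i (v 0 i)%:~R ^+ 2).

Definition assumption1 (d : nat) (lam h rho : R) (K : nat) (c1 : R) : Prop :=
  forall j : mode d K,
    let x := enorm (mode_pt j) ^+ 2 * h in
    (cos x - h * lam * rho ^+ 2 * sin x) ^+ 2 <= 1 - c1 * h ^+ 2.

Definition frequency (d : nat) (lam h rho : R) (K : nat) (j : mode d K) : R :=
  let x := enorm (mode_pt j) ^+ 2 * h in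
  acos (cos x - h * lam * rho ^+ 2 * sin x)
    / (h * Num.sg (sin x + h * lam * rho ^+ 2 * cos x)).

Definition expi (t : R) : R[i] := (cos t +i* sin t)%C.

Definition klen (d K : nat) (k : mode d K -> int) : nat :=
  (\sum_j `|k j|)%N.

Definition kdot (d K : nat) (k : mode d K -> int) (w : mode d K -> R) : R :=
  \sum_j (k j)%:~R * w j.

Definition nonresonance (d : nat) (h : R) (K N : nat) (c2 delta2 s2 : R)
    (w : mode d K -> R) : Prop :=
  forall k : mode d K -> int,
    (0 < klen k <= N.+1)%N ->
    (forall j, k j != 0 -> forall l, l != j -> w l = w j -> k l = 0) ->
    let delta : R := Normc.normc ((expi (kdot k w * h) - 1) / h%:C%C) in
    delta <= delta2 ->
    forall l, k l != 0 ->
      enorm (mode_pt l) ^+ 4 / \prod_j enorm (mode_pt j) ^+ (2 * `|k j|)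
        <= c2 * powR delta (N%:R / s2).

Definition exact_resonance (d : nat) (h : R) (K N : nat)
    (w : mode d K -> R) : Prop :=
  forall k : mode d K -> int,
    (klen k <= N.+1)%N ->
    (exists z : int, h * kdot k w = 2 * pi * z%:~R) ->
    forall m : int,
      \sum_(j : mode d K | enorm (mode_pt j) ^+ 2 == m%:~R) k j = 0.

Definition assumption2 (d : nat) (lam h rho : R) (K N : nat)
    (eps c2 delta2 s2 : R) : Prop :=
  exists w : mode d K -> R,
    [/\ forall j, `|w j - frequency lam h rho j| <= eps,
        nonresonance h N c2 delta2 s2 w
      & exact_resonance h N w].

End Assumptions.

(* Main.v *)
Require Import Defs.
From mathcomp Require Import all_boot all_order all_algebra.
From mathcomp Require Import all_classical all_reals all_analysis.
From mathcomp Require Import measurable_realfun.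
From mathcomp Require Import ring lra zify.
From mathcomp.real_closed Require Import complex.
Set Implicit Arguments.
Unset Strict Implicit.
Unset Printing Implicit Defensive.
Import Order.TTheory GRing.Theory Num.Theory.
Import numFieldNormedType.Exports.
Local Open Scope classical_set_scope.
Local Open Scope ring_scope.

(** Write n = |j|^2, mu = lam rho^2 and take as modified frequencies
      w_n = sqrt (n (n + 2 mu)) + (1 - n h cot (n h)) mu^2 / (2 n),
    which agree with the frequencies of the scheme up to O(h^2): both sides have
    the same Taylor expansion in mu up to order two, uniformly for n h <= pi / 3.
    The CFL condition keeps every phase h sum k_j w_j in [-pi, pi], so the claims
    concern the size of sum kappa_n w_n, with kappa_n the sum of k_j over
    |j|^2 = n.

    For fixed h, the derivatives of order >= 3 in mu of m + sum kappa_n w_n only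
    see the square roots, and those of order 3, ..., N + 3 form a Vandermonde
    system in the numbers 1 / (n + 2 mu).  Hence some derivative is bounded below
    by a power of the largest index M, the set of rho where the sum is smaller
    than e M^-a is small, and summing over M, kappa and m gives an exceptional set
    of (rho, h) of measure at most gamma.

    Off that set, let n1 >= n2 >= n3 be the largest indices of kappa.  If n2 is at
    most a constant times n3^a, the bound at level M = n1 is enough; otherwise the
    asymptotics w_n = n + mu + O(1 / n) turn the contribution of n1 and n2 into an
    integer, and the bound at level n3 applies. *)

(** The square roots are the limits of the frequencies as h tends to 0. Alone they miss the
    frequencies of the scheme by terms of size n h^2, which is no better than O(h) for the largest
    n; the cotangent term repairs this.

    Which derivative is large depends on the point, while the mean value theorem makes derivatives
    of different orders small at different points. The rho-interval is therefore cut into about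
    M^(2N+2) pieces, so short that no relevant derivative varies by more than half the Vandermonde
    bound. The natural variable is sig = rho^2, and separation in rho passes to sig only away from
    0, so a strip of small rho is given up for gamma/2; the resonances cost the other gamma/2.

    The exponent of s_2 is a square: nonresonance at level n1 costs n1^a, and n1 itself may be as
    large as n3^a, so the loss is n3^(a^2) with a quadratic in N. *)

(** * Taylor bounds for sine and cosine *)

Section TrigonometricBounds.
Variable R : realType.
Implicit Types p t x y z : R.

(** Drives a chain of Taylor bounds: each remainder of sine or cosine vanishes at 0 and has the
    previous remainder as derivative, starting from [1 - cos x >= 0]. *)
Lemma ge0_is_derive (f df : R -> R) : (forall x, is_derive x 1 f (df x)) ->
  f 0 = 0 -> (forall x, 0 <= x -> 0 <= df x) -> forall x, 0 <= x -> 0 <= f x.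
Proof.
move=> fdf f0 df_ge0 x x_ge0.
have [c cx fE] : exists2 c, c \in `[0, x] & f x - f 0 = df c * (x - 0).
  apply: MVT_segment => //.
  by apply: derivable_within_continuous => y _; apply: (@ex_derive _ _ _ _ _ _ _ (fdf y)).
move: fE cx; rewrite f0 !subr0 in_itv /= => -> /andP[c0 _].
by rewrite mulr_ge0 // df_ge0.
Qed.

Lemma sin_le_id t : 0 <= t -> sin t <= t.
Proof.
move=> t0; rewrite -subr_ge0.
apply: (@ge0_is_derive (fun x => x - sin x) (fun x => 1 - cos x)) => //.
by rewrite sin0 subr0.
Qed.

Lemma cos_ge_quadratic t : 0 <= t -> 1 - t ^+ 2 / 2 <= cos t.
Proof.
move=> t0; rewrite -subr_ge0.
apply: (@ge0_is_derive (fun x => cos x - (1 - x ^+ 2 / 2)) (fun x => x - sin x)) => //.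
- by move=> x; apply: is_derive_eq; rewrite /GRing.scale /=; field.
- by rewrite cos0; field.
- by move=> x x0; rewrite subr_ge0 sin_le_id.
Qed.

Lemma sin_ge_cubic t : 0 <= t -> t - t ^+ 3 / 6 <= sin t.
Proof.
move=> t0; rewrite -subr_ge0.
apply: (@ge0_is_derive (fun x => sin x - (x - x ^+ 3 / 6))
  (fun x => cos x - (1 - x ^+ 2 / 2))) => //.
- by move=> x; apply: is_derive_eq; rewrite /GRing.scale /=; field.
- by rewrite sin0; field.
- by move=> x x0; rewrite subr_ge0 cos_ge_quadratic.
Qed.

Lemma cos_le_quartic t : 0 <= t -> cos t <= 1 - t ^+ 2 / 2 + t ^+ 4 / 24.
Proof.
move=> t0; rewrite -subr_ge0.
apply: (@ge0_is_derive (fun x => 1 - x ^+ 2 / 2 + x ^+ 4 / 24 - cos x)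
  (fun x => sin x - (x - x ^+ 3 / 6))) => //.
- by move=> x; apply: is_derive_eq; rewrite /GRing.scale /=; field.
- by rewrite cos0; field.
- by move=> x x0; rewrite subr_ge0 sin_ge_cubic.
Qed.

Lemma norm_id_subr_sin p : `|p - sin p| <= `|p| ^+ 3.
Proof.
wlog p0 : p / 0 <= p => [H|].
  have [/H //|/ltW] := leP 0 p; rewrite -oppr_ge0 => /H.
  by rewrite sinN -opprD !normrN.
have := sin_le_id p0; have := sin_ge_cubic p0.
rewrite (ger0_norm p0) => h1 h2; rewrite ger0_norm ?subr_ge0 //.
have : 0 <= p ^+ 3 by rewrite exprn_ge0.
lra.
Qed.

Lemma norm_cos_quadratic p : `|p ^+ 2 / 2 - 1 + cos p| <= p ^+ 4.
Proof.
wlog p0 : p / 0 <= p => [H|].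
  have [/H //|/ltW] := leP 0 p; rewrite -oppr_ge0 => /H.
  by rewrite cosN sqrrN (exprM p 2 2) (exprM (- p) 2 2) sqrrN.
have h1 := cos_le_quartic p0; have h2 := cos_ge_quadratic p0.
have : 0 <= p ^+ 4 by rewrite exprn_ge0.
move=> p4; rewrite ler_norml; apply/andP; split; lra.
Qed.

Lemma pi_lt4 : pi < 4 :> R.
Proof. by have := @pihalf_lt2 R; lra. Qed.

(** As [t <= pi / 2 < 2], the cubic bound is at least t (1 - 4/6). *)
Lemma sin_ge_third t : 0 <= t <= pi / 2 -> t / 3 <= sin t.
Proof.
case/andP=> t0 tpi; apply: le_trans (sin_ge_cubic t0).
have t2 : t <= 2 by have := @pihalf_lt2 R; lra.
have : t * t <= 2 * 2 by rewrite ler_pM.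
rewrite (_ : t ^+ 3 = t * (t * t)); last by ring.
nra.
Qed.

Lemma norm_sin_ge_third t : `|t| <= pi / 2 -> `|t| / 3 <= `|sin t|.
Proof.
wlog t0 : t / 0 <= t => [H|].
  have [/H //|/ltW] := leP 0 t; rewrite -oppr_ge0 => /H.
  by rewrite sinN !normrN.
rewrite (ger0_norm t0) => tpi.
apply: le_trans (ler_norm _); apply: sin_ge_third; exact/andP.
Qed.

End TrigonometricBounds.

(** * Second-order expansion of the phase defined by the dispersion relation *)

Section FrequencyExpansion.
Variable R : realType.
Implicit Types h mu p u v x y B k : R.

(** Divided by 2 y, this is the coefficient of x^2 by which the phase u, given by
    [cos u = cos y - x * sin y], differs from the square root of y^2 + 2 x y at second order. *)
Definition cot_defect y : R := 1 - y * (cos y / sin y).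

Lemma third_pi_bounds y : 0 < y <= pi / 3 ->
  [/\ y < 4 / 3, y ^+ 2 <= 16 / 9, 0 < sin y, 0 < cos y & y / 2 <= sin y].
Proof.
case/andP=> y0 ypi; have pi4 := pi_lt4 R; have pi2 := @pi_ge2 R.
have y43 : y < 4 / 3 by lra.
have yy : y ^+ 2 <= 16 / 9 by rewrite expr2; nra.
split => //.
- by apply: sin_gt0_pi; apply/andP; split; lra.
- by apply: cos_gt0_pihalf; apply/andP; split; lra.
- apply: le_trans (sin_ge_cubic (ltW y0)); rewrite exprS; nra.
Qed.

(** The numerator sin y - y cos y is at least y^3/3 - y^5/24, which is nonnegative on this range,
    and at most y^3/2, which [sin y >= y / 2] turns into at most y^2 sin y. *)
Lemma cot_defect_bounds y : 0 < y <= pi / 3 -> 0 <= cot_defect y <= y ^+ 2.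
Proof.
move=> ybnd; have [y43 yy s0 c0 s2] := third_pi_bounds ybnd.
have y0 : 0 < y by case/andP: ybnd.
have AE : cot_defect y = (sin y - y * cos y) / sin y.
  by rewrite /cot_defect; field; rewrite gt_eqF.
rewrite AE ler_pdivlMr // ler_pdivrMr // mul0r.
have h1 := sin_le_id (ltW y0); have h2 := sin_ge_cubic (ltW y0).
have h3 := cos_ge_quadratic (ltW y0); have h4 := cos_le_quartic (ltW y0).
apply/andP; split.
  have : y * cos y <= y * (1 - y ^+ 2 / 2 + y ^+ 4 / 24) by rewrite ler_pM2l.
  have : 0 <= y ^+ 3 * (16 / 9 - y ^+ 2).
    by rewrite mulr_ge0 ?subr_ge0 // exprn_ge0 // ltW.
  have : 0 <= y ^+ 3 by rewrite exprn_ge0 // ltW.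
  rewrite (_ : y * (1 - y ^+ 2 / 2 + y ^+ 4 / 24) = y - y ^+ 3 / 2 + y ^+ 5 / 24); last by field.
  rewrite (_ : y ^+ 3 * (16 / 9 - y ^+ 2) = 16 / 9 * y ^+ 3 - y ^+ 5); last by field.
  lra.
have : y * (1 - y ^+ 2 / 2) <= y * cos y by rewrite ler_pM2l.
have : y ^+ 2 * (y / 2) <= y ^+ 2 * sin y by rewrite ler_pM2l // exprn_gt0.
rewrite (_ : y ^+ 2 * (y / 2) = y ^+ 3 / 2); last by field.
rewrite (_ : y * (1 - y ^+ 2 / 2) = y - y ^+ 3 / 2); last by field.
lra.
Qed.

(** The relation reads 2 sin((u+y)/2) sin((u-y)/2) = x sin y. The first sine is at least y/6, so the
    factor y coming from sin y cancels and the bound is uniform as y tends to 0. *)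
Lemma phase_shift_bound u x y : 0 < y <= pi / 3 -> 0 <= u <= pi ->
  cos u = cos y - x * sin y -> `|u - y| <= 18 * `|x|.
Proof.
move=> ybnd /andP[u0 upi] cosu.
have [y43 yy s0 c0 s2] := third_pi_bounds ybnd.
have /andP[y0 ypi] := ybnd.
have prodE : 2 * sin ((u + y) / 2) * sin ((u - y) / 2) = x * sin y.
  have -> : x * sin y = cos y - cos u by rewrite cosu; ring.
  have -> : cos y = cos ((u + y) / 2 - (u - y) / 2) by congr cos; field.
  have -> : cos u = cos ((u + y) / 2 + (u - y) / 2) by congr cos; field.
  by rewrite cosB cosD; ring.
have s1 : y / 6 <= sin ((u + y) / 2).
  have [zpi|zpi] := leP ((u + y) / 2) (pi / 2).
    have : (u + y) / 2 / 3 <= sin ((u + y) / 2).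
      by apply: sin_ge_third; rewrite zpi andbT; lra.
    by move=> H; apply: le_trans H; lra.
  (* Beyond pi/2 the half-sum is reflected; it stays below 2 pi/3, so the reflected angle is still
     at least y. *)
  have -> : sin ((u + y) / 2) = sin (pi - (u + y) / 2).
    by rewrite sinB sinpi cospi; ring.
  have : (pi - (u + y) / 2) / 3 <= sin (pi - (u + y) / 2).
    by apply: sin_ge_third; apply/andP; split; lra.
  by move=> H; apply: le_trans H; lra.
have s3 : `|(u - y) / 2| / 3 <= `|sin ((u - y) / 2)|.
  by apply: norm_sin_ge_third; rewrite ler_norml; apply/andP; split; lra.
have : 2 * sin ((u + y) / 2) * `|sin ((u - y) / 2)| <= `|x| * y.
  have -> : 2 * sin ((u + y) / 2) * `|sin ((u - y) / 2)| = `|x * sin y|.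
    by rewrite -prodE !normrM (ger0_norm (x := 2)) // (ger0_norm (x := sin _)) //; lra.
  rewrite normrM ler_pM // ger0_norm; [exact/sin_le_id/ltW | exact: ltW].
have -> : `|u - y| = 2 * `|(u - y) / 2|.
  by rewrite normrM (ger0_norm (x := 2^-1)) //; field.
set P := `|(u - y) / 2| in s3 *; set S := `|sin _| in s3 *; set T := sin _ in s1 *.
move=> H; have P0 : 0 <= P by rewrite normr_ge0.
have x0 : 0 <= `|x| by [].
rewrite -(ler_pM2r y0); apply: le_trans (_ : 36 * (y / 6 * (P / 3)) <= _).
  by rewrite le_eqVlt; apply/orP; left; apply/eqP; field.
have : y / 6 * (P / 3) <= T * S by apply: ler_pM; clear - y0 P0 s1 s3; lra.
by clear - H; lra.
Qed.

(* With p = u - y and q = v - y, the two dispersion relations give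
   (p - q) (u + v) = A p^2 + 2 (1 - A) (p^2/2 - 1 + cos p) + 2 y (p - sin p)
   where A = cot_defect y; everything beyond A x^2 is cubic in x. *)
Lemma phase_expansion u v x y B k0 : 0 < y <= pi / 3 -> 0 <= u <= pi ->
  cos u = cos y - x * sin y -> 0 <= B -> `|x| <= B * y -> 0 < k0 ->
  k0 * y <= v -> v ^+ 2 = y ^+ 2 + 2 * x * y ->
  `|u - v - cot_defect y * x ^+ 2 / (2 * y)|
    <= (5832 * (36 * B + 2) + 6156 * (32 * B + 2) + 10) / k0 * `|x| ^+ 3.
Proof.
move=> ybnd ubnd cosu B0 xB k00 vy vE.
have [y43 yy s0 c0 s2] := third_pi_bounds ybnd.
have /andP[y0 ypi] := ybnd; have /andP[u0 upi] := ubnd.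
have p18 := phase_shift_bound ybnd ubnd cosu.
have /andP[A0 A1] := cot_defect_bounds ybnd.
have v0 : 0 < v by apply: lt_le_trans vy; rewrite mulr_gt0.
set p := u - y in p18; pose q := v - y.
have x0 : 0 <= `|x| by [].
have pn0 : 0 <= `|p| by [].
have q2 : `|q| <= 2 * `|x|.
  have : `|q| * (v + y) = 2 * `|x| * y.
    rewrite -[in LHS](ger0_norm (x := v + y)) -?normrM; last by lra.
    have -> : q * (v + y) = 2 * x * y.
      have -> : q * (v + y) = v ^+ 2 - y ^+ 2 by rewrite /q; ring.
      by rewrite vE; ring.
    by rewrite !normrM (ger0_norm (x := 2)) // (ger0_norm (x := y)) // ltW.
  have : 0 <= `|q| by [].
  move=> qn0 E; rewrite -(ler_pM2r y0) -E ler_wpM2l //; lra.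
set A := cot_defect y in A0 A1 *.
have cotE : y * (cos y / sin y) = 1 - A by rewrite /A /cot_defect; ring.
have xpE : y * (x - p) = (1 - A) * (1 - cos p) - y * (p - sin p).
  have : x * sin y = cos y * (1 - cos p) + sin y * sin p.
    have -> : x * sin y = cos y - cos u by rewrite cosu; ring.
    have -> : u = y + p by rewrite /p; ring.
    by rewrite cosD; ring.
  move=> E; have -> : x = cos y / sin y * (1 - cos p) + sin p.
    by rewrite -[LHS](mulfK (lt0r_neq0 s0)) E; field; rewrite gt_eqF.
  by rewrite -cotE; field; rewrite gt_eqF.
have r2 := norm_cos_quadratic p; have r3 := norm_id_subr_sin p.
set P := `|p| in p18 pn0 r3; set X := `|x| in x0 p18 q2 xB *.
have p2E : p ^+ 2 = P ^+ 2 by rewrite /P real_normK // num_real.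
have p4E : p ^+ 4 = P ^+ 4 by rewrite (exprM p 2 2) p2E -exprM.
have PB : P <= 18 * B * y by clear - p18 xB; lra.
have P3X : P ^+ 3 <= 5832 * X ^+ 3.
  have -> : 5832 * X ^+ 3 = (18 * X) ^+ 3 by ring.
  by rewrite lerXn2r // nnegrE mulr_ge0.
have P2X : P ^+ 2 <= 324 * X ^+ 2.
  have -> : 324 * X ^+ 2 = (18 * X) ^+ 2 by ring.
  by rewrite lerXn2r // nnegrE mulr_ge0.
have A2 : `|1 - A| <= 1 by clear - A0 A1 yy; rewrite ler_norml; apply/andP; split; lra.
have P20 : 0 <= P ^+ 2 by rewrite exprn_ge0.
have P30 : 0 <= P ^+ 3 by rewrite exprn_ge0.
have X30 : 0 <= X ^+ 3 by rewrite exprn_ge0.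
have cos1 : `|1 - cos p| <= P ^+ 2 / 2.
  rewrite ger0_norm ?subr_ge0 ?cos_le1 // -(cos_norm p).
  by have := cos_ge_quadratic pn0; rewrite -/P; clear; lra.
have xp : `|x - p| * y <= P ^+ 2 * (32 * B + 2).
  have -> : `|x - p| * y = `|y * (x - p)|.
    by rewrite normrM (ger0_norm (ltW y0)) mulrC.
  rewrite xpE; apply: le_trans (ler_normB _ _) _; rewrite !normrM (ger0_norm (ltW y0)).
  have h1 : `|1 - A| * `|1 - cos p| <= 1 * (P ^+ 2 / 2) by rewrite ler_pM.
  have h2 : y * `|p - sin p| <= y * P ^+ 3 by rewrite ler_pM2l.
  have h3 : y * P ^+ 3 <= 32 * B * P ^+ 2.
    have -> : y * P ^+ 3 = (y * P) * P ^+ 2 by ring.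
    rewrite ler_wpM2r //.
    have : y * P <= y * (18 * B * y) by rewrite ler_pM2l.
    have -> : y * (18 * B * y) = 18 * B * y ^+ 2 by ring.
    have : 18 * B * y ^+ 2 <= 18 * B * (16 / 9) by clear - B0 yy; rewrite ler_wpM2l //; lra.
    by clear; lra.
  by clear - h1 h2 h3 P20; lra.
have mainE : (u - v - A * x ^+ 2 / (2 * y)) * (u + v) =
    A * (p - x) * (p + x) + 2 * (1 - A) * (p ^+ 2 / 2 - 1 + cos p)
    + 2 * y * (p - sin p) - A * x ^+ 2 * (p + q) / (2 * y).
  have -> : u = y + p by rewrite /p; ring.
  have vq : v = y + q by rewrite /q; ring.
  have qE : 2 * y * q + q ^+ 2 = 2 * x * y.
    have -> : 2 * y * q + q ^+ 2 = v ^+ 2 - y ^+ 2 by rewrite vq; ring.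
    by rewrite vE; ring.
  have e1 : (y + p - v) * (y + p + v) = 2 * y * p + p ^+ 2 - 2 * x * y.
    by rewrite vq -qE; ring.
  have e2 : 2 * x * y = 2 * y * p + 2 * ((1 - A) * (1 - cos p) - y * (p - sin p)).
    by rewrite -xpE; ring.
  rewrite mulrBl e1 {1}e2 vq; clear - y0; field; lra.
have t1 : `|A * (p - x) * (p + x)| <= 6156 * (32 * B + 2) * y * X ^+ 3.
  rewrite !normrM (ger0_norm A0) (distrC p x).
  have : `|p + x| <= 19 * X by apply: le_trans (ler_normD _ _) _; rewrite -/P -/X; clear - p18; lra.
  move=> h1.
  apply: le_trans (_ : y ^+ 2 * `|x - p| * (19 * X) <= _).
    by rewrite ler_pM // ?mulr_ge0 // ler_wpM2r.
  have -> : y ^+ 2 * `|x - p| * (19 * X) = (`|x - p| * y) * (19 * X * y) by ring.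
  apply: le_trans (_ : (324 * X ^+ 2 * (32 * B + 2)) * (19 * X * y) <= _).
    have h2 : 0 <= 32 * B + 2 by clear - B0; lra.
    rewrite ler_wpM2r // ?mulr_ge0 // ?(ltW y0) //.
    by apply: le_trans xp _; rewrite ler_wpM2r //.
  by rewrite le_eqVlt; apply/orP; left; apply/eqP; ring.
have t2 : `|2 * (1 - A) * (p ^+ 2 / 2 - 1 + cos p)| <= 36 * B * y * P ^+ 3.
  rewrite !normrM (ger0_norm (x := 2)) //.
  have : `|1 - A| * `|p ^+ 2 / 2 - 1 + cos p| <= 1 * P ^+ 4.
    by rewrite ler_pM // -p4E.
  have -> : 1 * P ^+ 4 = P * P ^+ 3 by ring.
  have : P * P ^+ 3 <= 18 * B * y * P ^+ 3 by rewrite ler_wpM2r.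
  by move=> h1 h2; rewrite -mulrA; clear - h1 h2; lra.
have t3 : `|2 * y * (p - sin p)| <= 2 * y * P ^+ 3.
  by rewrite normrM ger0_norm ?ler_wpM2l // mulr_ge0 // ltW.
have t4 : `|A * x ^+ 2 * (p + q) / (2 * y)| <= 10 * y * X ^+ 3.
  rewrite normrM normfV normrM (normrM A) normrX (ger0_norm A0) -/X.
  rewrite (ger0_norm (x := 2 * y)); last by clear - y0; lra.
  rewrite ler_pdivrMr; last by clear - y0; lra.
  have : `|p + q| <= 20 * X by apply: le_trans (ler_normD _ _) _; rewrite -/P; clear - p18 q2; lra.
  move=> h1; apply: le_trans (_ : y ^+ 2 * X ^+ 2 * (20 * X) <= _).
    rewrite ler_pM // ?mulr_ge0 // ?exprn_ge0 //.
    by rewrite ler_wpM2r // exprn_ge0.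
  by rewrite le_eqVlt; apply/orP; left; apply/eqP; ring.
set C := 5832 * _ + _ + 10.
have C0 : 0 <= C by rewrite /C; clear - B0; lra.
(* Multiplication by u + v, which is at least k0 y, gives access to [mainE]; each of its four terms
   is bounded by a multiple of y |x|^3, so the factor y cancels again. *)
rewrite -(ler_pM2r (_ : 0 < k0 * y)) ?mulr_gt0 //.
apply: le_trans (_ : `|(u - v - A * x ^+ 2 / (2 * y)) * (u + v)| <= _).
  by rewrite normrM ler_wpM2l // ger0_norm; clear - vy v0 u0; lra.
have -> : C / k0 * X ^+ 3 * (k0 * y) = C * y * X ^+ 3 by clear - k00; field; lra.
rewrite mainE.
apply: le_trans (ler_normB _ _) _; apply: le_trans (lerD (ler_normD _ _) (lexx _)) _.
apply: le_trans (lerD (lerD (ler_normD _ _) (lexx _)) (lexx _)) _.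
have h5 : (36 * B + 2) * y * P ^+ 3 <= (36 * B + 2) * y * (5832 * X ^+ 3).
  by clear - B0 y0 P3X; rewrite ler_wpM2l // mulr_ge0; lra.
have -> : C * y * X ^+ 3 = (36 * B + 2) * y * (5832 * X ^+ 3) +
   6156 * (32 * B + 2) * y * X ^+ 3 + 10 * y * X ^+ 3 by rewrite /C; ring.
move: h5; rewrite (_ : (36 * B + 2) * y * P ^+ 3 = 36 * B * y * P ^+ 3 + 2 * y * P ^+ 3); last by ring.
by clear - t1 t2 t3 t4; lra.
Qed.

End FrequencyExpansion.

(** * Modified frequencies: asymptotics, stability and distance to the frequencies of the scheme *)

Section ModifiedFrequency.
Variable R : realType.
Implicit Types h mu B m : R.

Definition shift_coef (n : nat) h : R := cot_defect (n%:R * h) / (2 * n%:R).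

Definition mod_freq (n : nat) mu h : R :=
  Num.sqrt (n%:R * (n%:R + 2 * mu)) + shift_coef n h * mu ^+ 2.

(** The worst case is n = 1, because (1 - k0)(n - 1) is nonnegative. *)
Lemma dispersion_ge (n : nat) mu (k0 : R) : (0 < n)%N -> k0 <= 1 ->
  k0 <= 1 + 2 * mu -> k0 * n%:R <= n%:R + 2 * mu.
Proof.
move=> n0 k1 kmu; have : (1 : R) <= n%:R by rewrite ler1n.
nra.
Qed.

(** Two bounds for two purposes: 1/n keeps the asymptotics of the frequencies uniform in h, and n
    h^2/2 keeps the phases within the CFL budget. *)
Lemma shift_coef_bounds (n : nat) h : (0 < n)%N -> 0 < h -> n%:R * h <= pi / 3 ->
  0 <= shift_coef n h <= n%:R^-1 /\ shift_coef n h <= n%:R * h ^+ 2 / 2.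
Proof.
move=> n0 h0 nh; have n0R : 0 < n%:R :> R by rewrite ltr0n.
have ybnd : 0 < n%:R * h <= pi / 3 by rewrite mulr_gt0.
have [_ yy _ _ _] := third_pi_bounds ybnd.
have /andP[A0 A1] := cot_defect_bounds ybnd.
have n20 : 0 < 2 * n%:R :> R by lra.
rewrite /shift_coef divr_ge0 ?(ltW n20) //= !ler_pdivrMr //; split.
  rewrite mulrCA mulVf ?gt_eqF // mulr1; lra.
apply: le_trans A1 _.
by rewrite le_eqVlt; apply/orP; left; apply/eqP; field.
Qed.

(** With S the square root, (S - n - mu)(S + n + mu) = - mu^2, and the second factor is at least n/2
    since n + 2 mu is positive. *)
Lemma mod_freq_asymptotics (n : nat) mu h B (k0 : R) : (0 < n)%N -> 0 < k0 <= 1 ->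
  k0 <= 1 + 2 * mu -> `|mu| <= B -> 0 < h -> n%:R * h <= pi / 3 ->
  `|mod_freq n mu h - n%:R - mu| <= 3 * B ^+ 2 / n%:R.
Proof.
move=> n0 /andP[k00 k01] kmu muB h0 nh; have n0R : 0 < n%:R :> R by rewrite ltr0n.
have /andP[a0 a1] := (shift_coef_bounds n0 h0 nh).1.
have disp := dispersion_ge n0 k01 kmu.
have disp0 : 0 < n%:R + 2 * mu by apply: lt_le_trans disp; rewrite mulr_gt0.
have B0 : 0 <= B by apply: le_trans muB.
have mu2 : mu ^+ 2 <= B ^+ 2.
  by rewrite -(real_normK (num_real mu)) lerXn2r // nnegrE.
rewrite /mod_freq; set S := Num.sqrt _.
have S0 : 0 <= S by rewrite sqrtr_ge0.
have SE : S ^+ 2 = n%:R * (n%:R + 2 * mu) by rewrite sqr_sqrtr // mulr_ge0 // ltW.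
have main : `|S - n%:R - mu| <= 2 * B ^+ 2 / n%:R.
  rewrite ler_pdivlMr //.
  have E : (S - n%:R - mu) * (S + n%:R + mu) = - mu ^+ 2.
    have -> : (S - n%:R - mu) * (S + n%:R + mu) = S ^+ 2 - (n%:R + mu) ^+ 2 by ring.
    by rewrite SE; ring.
  have d0 : n%:R / 2 <= S + n%:R + mu by clear - disp0 S0; lra.
  have : `|S - n%:R - mu| * (S + n%:R + mu) = mu ^+ 2.
    rewrite -[X in _ * X]ger0_norm; last by clear - d0 n0R; lra.
    by rewrite -normrM E normrN ger0_norm // sqr_ge0.
  have : `|S - n%:R - mu| * (n%:R / 2) <= `|S - n%:R - mu| * (S + n%:R + mu).
    by rewrite ler_wpM2l.
  by clear - mu2; lra.
have -> : S + shift_coef n h * mu ^+ 2 - n%:R - mu =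
  (S - n%:R - mu) + shift_coef n h * mu ^+ 2 by ring.
apply: le_trans (ler_normD _ _) _.
have : `|shift_coef n h * mu ^+ 2| <= B ^+ 2 / n%:R.
  have mu20 := sqr_ge0 mu.
  have am0 : 0 <= shift_coef n h * mu ^+ 2 by apply: mulr_ge0.
  rewrite (ger0_norm am0) (mulrC (B ^+ 2)); exact: ler_pM.
by clear - main; lra.
Qed.

(** The square root is at most n + B and the correction at most B, which reproduces the shape of the
    left side of the CFL condition. *)
Lemma mod_freq_scaled_le (n : nat) mu h B (k0 : R) : (0 < n)%N -> 0 < k0 <= 1 ->
  k0 <= 1 + 2 * mu -> `|mu| <= B -> 0 < h -> n%:R * h <= pi / 3 ->
  2 * h * B <= pi / 3 -> 0 <= h * mod_freq n mu h <= n%:R * h + 2 * h * B.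
Proof.
move=> n0 /andP[k00 k01] kmu muB h0 nh hB; have n0R : 0 < n%:R :> R by rewrite ltr0n.
have [/andP[a0 _] a1] := shift_coef_bounds n0 h0 nh.
have disp := dispersion_ge n0 k01 kmu.
have B0 : 0 <= B by apply: le_trans muB.
have pi4 := pi_lt4 R.
have am0 : 0 <= shift_coef n h * mu ^+ 2 by apply: mulr_ge0 => //; apply: sqr_ge0.
rewrite /mod_freq mulr_ge0 ?(ltW h0) ?addr_ge0 ?sqrtr_ge0 //=.
have -> : n%:R * h + 2 * h * B = h * ((n%:R + B) + B) by ring.
rewrite ler_wpM2l ?(ltW h0) // lerD //.
  rewrite -[leRHS]ger0_norm ?addr_ge0 // -sqrtr_sqr ler_sqrt; last by rewrite sqr_ge0.
  have : mu <= B by apply: le_trans muB; rewrite ler_norm.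
  move=> muB'; have : n%:R * mu <= n%:R * B by rewrite ler_pM2l.
  by move=> H; rewrite sqrrD; have := sqr_ge0 B; clear - H; rewrite !expr2 mulr2n; lra.
have mu2 : mu ^+ 2 <= B * B.
  by rewrite -(real_normK (num_real mu)) expr2 ler_pM.
apply: le_trans (_ : n%:R * h ^+ 2 / 2 * (B * B) <= _).
  by rewrite ler_pM // sqr_ge0.
have -> : n%:R * h ^+ 2 / 2 * (B * B) = (n%:R * h) * (2 * h * B) / 4 * B by field.
rewrite -[leRHS]mul1r ler_wpM2r //.
have : (n%:R * h) * (2 * h * B) <= 4 / 3 * (4 / 3).
  by apply: ler_pM; rewrite ?mulr_ge0 // ?(ltW h0) ?(ltW n0R) //; clear - nh hB pi4; lra.
by clear; lra.
Qed.

(** This is tan(y/2) >= y/2, that is, [cot_defect (y / 2) >= 0]. The sharp constant 1/2 matters: in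
    [stability_gap] a negative h mu may cancel all of y/2 except a fraction k0. *)
Lemma one_subr_cos_ge (y : R) : 0 < y <= pi / 3 -> y / 2 * sin y <= 1 - cos y.
Proof.
move=> ybnd; have /andP[y0 ypi] := ybnd.
have zbnd : 0 < y / 2 <= pi / 3 by apply/andP; split; lra.
have [_ _ s0 _ _] := third_pi_bounds zbnd.
have /andP[A0 _] := cot_defect_bounds zbnd.
have -> : sin y = 2 * sin (y / 2) * cos (y / 2).
  by rewrite -[in LHS](_ : (y / 2) *+ 2 = y) ?sin_mulr2n; field.
have -> : cos y = 1 - 2 * sin (y / 2) ^+ 2.
  rewrite -[in LHS](_ : (y / 2) *+ 2 = y); last by field.
  by rewrite cos_mulr2n cos2sin2; ring.
have -> : 1 - (1 - 2 * sin (y / 2) ^+ 2) = y / 2 * (2 * sin (y / 2) * cos (y / 2))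
   + 2 * sin (y / 2) ^+ 2 * cot_defect (y / 2).
  by rewrite /cot_defect; field; rewrite gt_eqF.
by rewrite lerDl !mulr_ge0 // ltW.
Qed.

(** With X the base of the square, 1 - X^2 = (1 - X)(1 + X); the first factor is at least k0 h^2/4
    and the second at least 1/3. *)
Lemma stability_gap (n : nat) mu h B (k0 : R) : (0 < n)%N -> 0 < k0 <= 1 ->
  k0 <= 1 + 2 * mu -> `|mu| <= B -> 0 < h -> n%:R * h <= pi / 3 ->
  2 * h * B <= pi / 3 ->
  (cos (n%:R * h) - h * mu * sin (n%:R * h)) ^+ 2 <= 1 - k0 / 12 * h ^+ 2.
Proof.
move=> n0 /andP[k00 k01] kmu muB h0 nh hB; have n1R : 1 <= n%:R :> R by rewrite ler1n.
have pi4 := pi_lt4 R.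
have hy : h <= n%:R * h by rewrite ler_peMl // ltW.
set y := n%:R * h in nh hy *.
have ybnd : 0 < y <= pi / 3 by rewrite nh andbT; apply: lt_le_trans hy.
have [_ _ s0 c0 s2] := third_pi_bounds ybnd; have s1 := sin_le1 y.
have gap := one_subr_cos_ge ybnd; have /andP[y0 _] := ybnd.
have hmu : - ((1 - k0) / 2) * y <= h * mu.
  have : h * (k0 - 1) <= h * (2 * mu) by rewrite ler_pM2l //; clear - kmu; lra.
  have : (1 - k0) * h <= (1 - k0) * y by rewrite ler_wpM2l //; clear - k01; lra.
  by clear; lra.
set x := h * mu in hmu *.
have xB : x <= 2 / 3.
  have : h * mu <= h * B by rewrite ler_pM2l // (le_trans _ muB) // ler_norm.
  by rewrite -/x; clear - hB pi4; lra.
have e1 : k0 / 4 * h ^+ 2 <= 1 - (cos y - x * sin y).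
  apply: le_trans (_ : k0 / 2 * y * sin y <= _).
    have -> : k0 / 4 * h ^+ 2 = k0 / 2 * h * (h / 2) by field.
    by apply: ler_pM; rewrite ?mulr_ge0 ?ler_wpM2l //; clear - k00 h0 hy s2; lra.
  have : (k0 / 2 * y) * sin y <= (y / 2 + x) * sin y.
    by rewrite ler_pM2r //; clear - hmu; lra.
  by clear - gap; lra.
have e2 : 1 / 3 <= 1 + (cos y - x * sin y).
  have : x * sin y <= 2 / 3 * 1.
    have [x0|x0] := leP 0 x; first by rewrite ler_pM // ltW.
    apply: (@le_trans _ _ 0); last by clear; lra.
    by rewrite mulr_le0_ge0 ?ltW.
  by clear - c0; lra.
have : k0 / 4 * h ^+ 2 * (1 / 3) <= (1 - (cos y - x * sin y)) * (1 + (cos y - x * sin y)).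
  by apply: ler_pM => //; rewrite ?mulr_ge0 ?sqr_ge0 //; clear - k00 h0; lra.
rewrite (_ : (1 - (cos y - x * sin y)) * _ = 1 - (cos y - x * sin y) ^+ 2); last by ring.
by clear; lra.
Qed.

(** Nonnegativity of [cot_defect] means sin y >= y cos y, so the sum is at least (y + h mu) cos y.
    Hence the sign in the definition of the frequencies is +1. *)
Lemma frequency_sign (n : nat) mu h (k0 : R) : (0 < n)%N -> 0 < k0 <= 1 ->
  k0 <= 1 + 2 * mu -> 0 < h -> n%:R * h <= pi / 3 ->
  0 < sin (n%:R * h) + h * mu * cos (n%:R * h).
Proof.
move=> n0 /andP[k00 k01] kmu h0 nh; have n1R : 1 <= n%:R :> R by rewrite ler1n.
have hy : h <= n%:R * h by rewrite ler_peMl // ltW.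
set y := n%:R * h in nh hy *.
have ybnd : 0 < y <= pi / 3 by rewrite nh andbT; apply: lt_le_trans hy.
have [_ _ s0 c0 _] := third_pi_bounds ybnd.
have /andP[A0 _] := cot_defect_bounds ybnd.
have yc : y * cos y <= sin y.
  rewrite -subr_ge0 (_ : sin y - y * cos y = sin y * cot_defect y).
    by rewrite mulr_ge0 // ltW.
  by rewrite /cot_defect; field; rewrite gt_eqF.
apply: (@lt_le_trans _ _ ((y + h * mu) * cos y)); last by rewrite mulrDl lerD2r.
rewrite mulr_gt0 //.
have : h * (k0 - 1) <= h * (2 * mu) by rewrite ler_pM2l //; clear - kmu; lra.
have : 0 < h * k0 by rewrite mulr_gt0.
by clear - hy h0; lra.
Qed.

Lemma mod_freq_approx (B k0 : R) : 0 <= B -> 0 < k0 <= 1 -> exists2 C, 0 < C &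
  forall (n : nat) mu h, (0 < n)%N -> k0 <= 1 + 2 * mu -> `|mu| <= B -> 0 < h ->
  n%:R * h <= pi / 3 -> 2 * h * B <= pi / 3 ->
  `|mod_freq n mu h - acos (cos (n%:R * h) - h * mu * sin (n%:R * h)) / h|
    <= C * h ^+ 2.
Proof.
move=> B0 kbnd; have /andP[k00 k01] := kbnd.
have [C CE C0] : exists2 C,
    (5832 * (36 * B + 2) + 6156 * (32 * B + 2) + 10) / k0 = C & 0 <= C.
  by eexists; first reflexivity; apply: divr_ge0; [clear - B0; lra | exact: ltW].
(* [phase_expansion] has error C (B h)^3 for the phases, and dividing by h leaves h^2; the summand 1
   makes the constant positive. *)
exists (C * B ^+ 3 + 1) => [|n mu h n0 kmu muB h0 nh hB].
  by rewrite ltr_wpDl // mulr_ge0 // exprn_ge0.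
have n1R : 1 <= n%:R :> R by rewrite ler1n.
have n0R : 0 < n%:R :> R by rewrite ltr0n.
have gap := stability_gap n0 kbnd kmu muB h0 nh hB.
have hy : h <= n%:R * h by rewrite ler_peMl // ltW.
have y0 : 0 < n%:R * h by rewrite mulr_gt0.
have ybnd : 0 < n%:R * h <= pi / 3 by rewrite y0.
set X := cos _ - _ in gap *.
have X1 : -1 <= X <= 1.
  rewrite -ler_norml -(@ler_pXn2r _ 2) ?nnegrE // expr1n real_normK ?num_real //.
  by apply: le_trans gap _; rewrite gerBl mulr_ge0 ?sqr_ge0 //; clear - k00; lra.
have ubnd : 0 <= acos X <= pi by rewrite acos_ge0 // acos_lepi.
have cosu : cos (acos X) = cos (n%:R * h) - h * mu * sin (n%:R * h).
  by rewrite acosK // in_itv.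
have xB : `|h * mu| <= B * (n%:R * h).
  by rewrite normrM gtr0_norm // mulrC ler_pM // ltW.
have disp := dispersion_ge n0 k01 kmu.
have disp0 : 0 <= n%:R + 2 * mu by apply: le_trans disp; rewrite mulr_ge0 // ltW.
set S := Num.sqrt (n%:R * (n%:R + 2 * mu)).
have SE : S ^+ 2 = n%:R * (n%:R + 2 * mu) by rewrite sqr_sqrtr // mulr_ge0 // ltW.
have vy : k0 * (n%:R * h) <= h * S.
  rewrite mulrA [leLHS]mulrC ler_pM2l // -(@ler_pXn2r _ 2) ?nnegrE ?sqrtr_ge0 //; last first.
    by rewrite mulr_ge0 // ltW.
  rewrite SE; apply: le_trans (_ : n%:R * (k0 * n%:R) <= _); last by rewrite ler_pM2l.
  have -> : (k0 * n%:R) ^+ 2 = k0 * (n%:R * (k0 * n%:R)) by ring.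
  by rewrite ler_piMl // !mulr_ge0 // ltW.
have vE : (h * S) ^+ 2 = (n%:R * h) ^+ 2 + 2 * (h * mu) * (n%:R * h).
  by rewrite exprMn SE; ring.
have := phase_expansion ybnd ubnd cosu B0 xB k00 vy vE.
rewrite CE => main.
have wE : mod_freq n mu h - acos X / h =
   - (acos X - h * S - cot_defect (n%:R * h) * (h * mu) ^+ 2 / (2 * (n%:R * h))) / h.
  by rewrite /mod_freq /shift_coef -/S; field; rewrite !gt_eqF.
rewrite wE normrM normrN normfV (gtr0_norm h0) ler_pdivrMr //.
apply: le_trans main _.
apply: le_trans (_ : C * (B * h) ^+ 3 <= _).
  rewrite ler_wpM2l // lerXn2r // ?nnegrE ?mulr_ge0 // ?(ltW h0) //.
  by rewrite normrM gtr0_norm // mulrC ler_wpM2r // ltW.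
rewrite (_ : (C * B ^+ 3 + 1) * h ^+ 2 * h = C * (B * h) ^+ 3 + h ^+ 3); last by ring.
by rewrite lerDl exprn_ge0 // ltW.
Qed.

End ModifiedFrequency.

(** * Integer combinations of frequencies indexed by the squared norm *)

Section SmallDivisors.
Variable R : realType.
Implicit Types (kap : nat -> int) (w : nat -> R) (L M n : nat).

Definition supported M kap := forall n, kap n != 0 -> (0 < n <= M)%N.

Definition coef_len L kap : nat := (\sum_(n < L.+1) `|kap n|)%N.

Definition coef_dot L kap w : R := \sum_(n < L.+1) (kap n)%:~R * w n.

(** For a supported family the index 0 contributes 0 ^ 0 = 1. *)
Definition coef_prod L kap : nat := (\prod_(n < L.+1) n ^ `|kap n|)%N.

Lemma coef_len0 L kap : supported L kap -> coef_len L kap = 0%N -> kap =1 (fun=> 0).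
Proof.
move=> sk /eqP; rewrite sum_nat_eq0 => /forallP k0 n.
apply/eqP/negPn/negP => kn; have /andP[_ nL] := sk _ kn.
by have /implyP/(_ isT) := k0 (Ordinal (nL : (n < L.+1)%N)); rewrite absz_eq0 (negPf kn).
Qed.

Lemma coef_prod_gt0 L kap : supported L kap -> (0 < coef_prod L kap)%N.
Proof.
move=> sk; rewrite prodn_gt0 // => n; rewrite expn_gt0.
have [->|kn] := eqVneq (kap n) 0; first by rewrite orbT.
by have /andP[-> _] := sk _ kn.
Qed.

(** Takes one unit, with its sign [s], off the coefficient of largest index. Since [s] is the sign
    of that coefficient, the length drops by exactly one, and iteration lists the indices in
    decreasing order with multiplicity. *)
Record peeling L kap (n : nat) (s : int) (kap' : nat -> int) : Prop := Peeling {
  peel_pos : (0 < n)%N;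
  peel_le : (n <= L)%N;
  peel_sgn : s = 1 \/ s = -1;
  peel_coef : forall i, kap i = kap' i + s * (i == n)%:Z;
  peel_abs : forall i, (`|kap i| = `|kap' i| + (i == n))%N;
  peel_supp : supported n kap }.

Lemma peelingP L kap : supported L kap -> (0 < coef_len L kap)%N ->
  exists n s kap', peeling L kap n s kap'.
Proof.
move=> sk klen.
have ex : exists n, kap n != 0.
  have [i ki] : exists i : 'I_L.+1, kap i != 0.
    apply/existsP; rewrite -negb_forall; apply: contraL klen => /forallP k0.
    rewrite -eqn0Ngt sum_nat_eq0; apply/forallP => i.
    by rewrite (eqP (k0 i)).
  by exists i.
have bnd n : kap n != 0 -> (n <= L)%N by move/sk/andP=> [].
case: (ex_maxnP ex bnd) => n kn nmax; have /andP[n0 nL] := sk _ kn.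
pose s : int := if 0 < kap n then 1 else -1.
exists n, s, (fun i => kap i - s * (i == n)%:Z); split => //.
- by rewrite /s; case: ifP; [left | right].
- by move=> i; rewrite subrK.
- move=> i; have [->|_] := eqVneq i n; last by rewrite mulr0 subr0 addn0.
  by rewrite mulr1 /s; case: (kap n) kn => [[|m]|m] //= _; lia.
- by move=> i ki; have /andP[-> _] := sk _ ki; rewrite nmax.
Qed.

Lemma peel_supp' L kap n s kap' : peeling L kap n s kap' -> supported n kap'.
Proof.
case=> _ _ _ _ kabs sk i ki; apply: sk; rewrite -absz_gt0 kabs.
by rewrite ltn_addr // absz_gt0.
Qed.

Lemma supported_le M L kap : (M <= L)%N -> supported M kap -> supported L kap.
Proof. by move=> ML sk n /sk/andP[-> nM]; rewrite (leq_trans nM). Qed.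

Lemma peel_len L kap n s kap' : peeling L kap n s kap' ->
  coef_len L kap = (coef_len L kap').+1.
Proof.
case=> _ nL _ _ kabs _; rewrite /coef_len.
under eq_bigr => i _ do rewrite kabs.
rewrite big_split /= -[RHS]addn1; congr (_ + _)%N.
rewrite (bigD1 (Ordinal (nL : (n < L.+1)%N))) //= eqxx big1 ?addn0 //.
by move=> i /negPf; rewrite -val_eqE /= => ->.
Qed.

Lemma peel_dot L kap n s kap' w : peeling L kap n s kap' ->
  coef_dot L kap w = coef_dot L kap' w + s%:~R * w n.
Proof.
case=> _ nL _ kE _ _.
rewrite /coef_dot (eq_bigr (fun i : 'I__ => (kap' i)%:~R * w i
  + (s * (i == n :> nat)%:Z)%:~R * w i)); last by move=> i _; rewrite kE intrD mulrDl.
rewrite big_split /=; congr (_ + _).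
rewrite (bigD1 (Ordinal (nL : (n < L.+1)%N))) //= eqxx mulr1 big1 ?addr0 //.
by move=> i /negPf; rewrite -val_eqE /= => ->; rewrite mulr0 mul0r.
Qed.

Lemma peel_prod L kap n s kap' : peeling L kap n s kap' ->
  coef_prod L kap = (coef_prod L kap' * n)%N.
Proof.
case=> _ nL _ _ kabs _.
rewrite /coef_prod (eq_bigr (fun i : 'I__ => i ^ `|kap' i| * i ^ (i == n :> nat))%N).
  rewrite big_split /=; congr (_ * _)%N.
  rewrite (bigD1 (Ordinal (nL : (n < L.+1)%N))) //= eqxx expn1 big1 ?muln1 //.
  by move=> i /negPf; rewrite -val_eqE /= => ->.
by move=> i _; rewrite kabs expnD.
Qed.

Lemma coef_dot0 L kap w : kap =1 (fun=> 0) -> coef_dot L kap w = 0.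
Proof. by move=> k0; rewrite /coef_dot big1 // => i _; rewrite k0 mul0r. Qed.

Lemma coef_dot_le L M kap w (G : R) : 0 <= G -> (M <= L)%N -> supported M kap ->
  (forall n, (0 < n <= L)%N -> `|w n - n%:R| <= G) ->
  `|coef_dot L kap w| <= (coef_len L kap)%:R * ((1 + G) * M%:R).
Proof.
move=> G0 ML sk wG; rewrite /coef_dot /coef_len natr_sum mulr_suml.
apply: le_trans (ler_norm_sum _ _ _) (ler_sum _ _) => i _.
have [->|ki] := eqVneq (kap i) 0; first by rewrite absz0 !mul0r normr0.
have /andP[i0 iM] := sk _ ki.
rewrite normrM natr_absz intr_norm ler_wpM2l //.
have := wG i; rewrite i0 (leq_trans iM) // => /(_ isT) wi.
have M1 : 1 <= M%:R :> R by rewrite ler1n (leq_trans i0).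
have iMR : (i : nat)%:R <= M%:R :> R by rewrite ler_nat.
have -> : w i = (w i - (i : nat)%:R) + (i : nat)%:R by rewrite subrK.
apply: le_trans (ler_normD _ _) _; rewrite (ger0_norm (ler0n _ _)).
by clear - wi G0 M1 iMR; nra.
Qed.

End SmallDivisors.

(** * Small divisors bounded below in terms of the third largest index *)

Section SmallDivisorEstimate.
Variable R : realType.
Implicit Types (kap : nat -> int) (w : nat -> R) (L M n : nat).

(** The integer [m] stands for the difference of two large indices. The cap on [|m|] leaves finitely
    many conditions at each level [M]; larger integers outweigh the sum once [Cp] is large. *)
Definition nonresonant (N Cp a L : nat) (e : R) w := forall M kap (m : int),
  (0 < M <= L)%N -> supported M kap -> (0 < coef_len L kap <= N.+1)%N ->
  (`|m| <= Cp * M)%N -> e / M%:R ^+ a <= `|m%:~R + coef_dot L kap w|.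

(** The threshold on [n2] has two tasks: its part C + 2G + N(1+G) excludes equal signs of the two
    leading terms, and its part 4 Cw/e makes the error 2 Cw/n2 in replacing w n1 - w n2 by n1 - n2
    at most half of e/n3^a. *)
Lemma small_divisor_third (N Cp a L : nat) (G C e Cw mu : R) w kap1 kap2 kap
    (n1 n2 n3 : nat) (s1 s2 : int) :
  0 <= G -> 0 <= Cw -> 0 < e <= 1 -> (0 < a)%N -> N%:R * (1 + G) + 1 <= Cp%:R ->
  (forall n, (0 < n <= L)%N -> `|w n - n%:R| <= G) ->
  (forall n, (0 < n <= L)%N -> `|w n - n%:R - mu| <= Cw / n%:R) ->
  nonresonant N Cp a L e w -> `|coef_dot L kap w| <= C ->
  (coef_len L kap <= N.+1)%N ->
  peeling L kap n1 s1 kap1 -> peeling L kap1 n2 s2 kap2 ->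
  (0 < n3 <= n2)%N -> supported n3 kap2 ->
  (C + 2 * G + N%:R * (1 + G) + 4 * Cw / e + 1) * n3%:R ^+ a < n2%:R ->
  e / 2 / n3%:R ^+ a <= `|coef_dot L kap w|.
Proof.
move=> G0 Cw0 /andP[e0 e1] a0 CpG wG wmu nr SC klen pk1 pk2 /andP[n30 n32] sk2 n2big.
have n1L := peel_le pk1; have n10 := peel_pos pk1.
have n2L := peel_le pk2; have n20 := peel_pos pk2.
have n21 : (n2 <= n1)%N.
  have : kap1 n2 != 0 by rewrite -absz_gt0 (peel_abs pk2) eqxx addn1.
  by move/(peel_supp' pk1)/andP=> [].
have n3L : (n3 <= L)%N by apply: leq_trans n32 _.
have C0 : 0 <= C by apply: le_trans SC.
have n31R : 1 <= n3%:R :> R by rewrite ler1n.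
have n3aR : n3%:R <= n3%:R ^+ a :> R by rewrite ler_eXnr.
have n3a1 : 1 <= n3%:R ^+ a :> R by rewrite exprn_ege1.
have k2len : (coef_len L kap2 <= N)%N.
  by move: klen; rewrite (peel_len pk1) (peel_len pk2) ltnS => /ltnW.
have N0 : 0 <= N%:R :> R by [].
have k2dot : `|coef_dot L kap2 w| <= N%:R * (1 + G) * n3%:R.
  apply: le_trans (coef_dot_le G0 n3L sk2 wG) _.
  rewrite mulrA ler_wpM2r // ler_wpM2r ?ler_nat //; clear - G0; lra.
have dotE : coef_dot L kap w = coef_dot L kap2 w + s2%:~R * w n2 + s1%:~R * w n1.
  by rewrite (peel_dot w pk1) (peel_dot w pk2).
have w1 := wG n1; rewrite n10 n1L in w1; have {}w1 := w1 isT.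
have w2 := wG n2; rewrite n20 n2L in w2; have {}w2 := w2 isT.
have n12R : n2%:R <= n1%:R :> R by rewrite ler_nat.
have n20R : 0 < n2%:R :> R by rewrite ltr0n.
have Cwe : 0 <= 4 * Cw / e by rewrite divr_ge0 ?mulr_ge0 // ltW.
have NG0 : 0 <= N%:R * (1 + G) by rewrite mulr_ge0 //; clear - G0; lra.
set T := n3%:R ^+ a in n3aR n3a1 n2big *.
set D := coef_dot L kap2 w in k2dot dotE *.
have n3bound : (C + 2 * G + N%:R * (1 + G)) * n3%:R + 4 * Cw / e * T + T < n2%:R.
  apply: le_lt_trans n2big; rewrite 2![in leRHS]mulrDl mul1r !lerD2r.
  by rewrite ler_wpM2l //; clear - C0 G0 NG0; lra.
have T0 : 0 < T by clear - n3a1; lra.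
have CT : C + 2 * G <= (C + 2 * G) * n3%:R by rewrite ler_peMr //; clear - C0 G0; lra.
have CeT : 0 <= 4 * Cw / e * T by rewrite mulr_ge0 // ltW.
(* equal signs: the sum is too large *)
have neq_sgn : s1 != s2.
  apply/eqP => s12.
  have : `|w n1 + w n2| <= C + N%:R * (1 + G) * n3%:R.
    have -> : `|w n1 + w n2| = `|coef_dot L kap w - D|.
      rewrite dotE s12; have [->|->] := peel_sgn pk2.
        by congr `|_|; ring.
      by rewrite -normrN; congr `|_|; ring.
    by apply: le_trans (ler_normB _ _) _; rewrite lerD.
  move=> h1; have : w n1 + w n2 <= C + N%:R * (1 + G) * n3%:R.
    by apply: le_trans h1; rewrite ler_norm.
  move: w1 w2; rewrite !ler_norml => /andP[w1 _] /andP[w2 _].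
  have NGn3 : 0 <= N%:R * (1 + G) * n3%:R by rewrite mulr_ge0.
  by have := n3bound; rewrite mulrDl; clear - w1 w2 T0 CeT CT n12R C0 G0 NGn3; lra.
have s21 : s2 = - s1.
  by case: (peel_sgn pk1) (peel_sgn pk2) neq_sgn => -> [] ->.
pose m : int := s1 * (n1%:Z - n2%:Z).
have s1R : `|s1%:~R| = 1 :> R by case: (peel_sgn pk1) => ->; rewrite ?mulrN1z ?normrN normr1.
have close : `|coef_dot L kap w - (m%:~R + D)| <= 2 * Cw / n2%:R.
  have -> : coef_dot L kap w - (m%:~R + D) =
      s1%:~R * ((w n1 - n1%:R - mu) - (w n2 - n2%:R - mu)).
    rewrite dotE s21 /m intrM intrB mulrNz; ring.
  rewrite normrM s1R mul1r; apply: le_trans (ler_normB _ _) _.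
  have h1 := wmu n1; rewrite n10 n1L in h1; have {}h1 := h1 isT.
  have h2 := wmu n2; rewrite n20 n2L in h2; have {}h2 := h2 isT.
  have : Cw / n1%:R <= Cw / n2%:R.
    by rewrite ler_wpM2l // lef_pV2 // posrE ltr0n.
  by clear - h1 h2; lra.
have far : e / T <= `|m%:~R + D|.
  have eT1 : e / T <= 1 by rewrite ler_pdivrMr // mul1r; clear - e1 n3a1; lra.
  (* Without further terms only the integer [m] remains; it is nonzero, since peeling the same index
     twice would have given equal signs. *)
  have [k20|k2pos] := posnP (coef_len L kap2).
    have k2z := coef_len0 (supported_le n3L sk2) k20.
    have n12 : n1 != n2.
      apply: contra_neqN neq_sgn => /eqP n12.
      have := peel_coef pk1 n1; have := peel_coef pk2 n2; have := peel_abs pk1 n1.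
      rewrite n12 eqxx k2z => h1 h2 h3; move: h1; rewrite h3 h2 add0r !mulr1.
      by case: (peel_sgn pk1) (peel_sgn pk2) => -> [] ->.
    rewrite /D coef_dot0 // addr0 -intr_norm; apply: le_trans eT1 _.
    rewrite (ler_int R 1) /m; move: n12; clear -n21 pk1.
    by case: (peel_sgn pk1) => ->; lia.
  (* Nonresonance covers [|m| <= Cp * n3]; beyond that, [m] exceeds the remaining sum by at least
     1. *)
  have [mM|mM] := leqP `|m| (Cp * n3).
    by apply: nr => //; rewrite ?n30 ?n3L // k2pos (leq_trans k2len).
  apply: le_trans eT1 _.
  have : (Cp * n3)%:R <= `|m%:~R| :> R.
    by rewrite -intr_norm -natr_absz ler_nat ltnW.
  rewrite natrM => h1.
  have : (N%:R * (1 + G) + 1) * n3%:R <= Cp%:R * n3%:R by rewrite ler_wpM2r.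
  have := lerB_normD (m%:~R : R) D.
  by clear - h1 k2dot n31R; lra.
have CwT : 2 * Cw / n2%:R <= e / 2 / T.
  rewrite ler_pdivrMr // mulrAC ler_pdivlMr //.
  have : e / 2 * (4 * Cw / e * T) <= e / 2 * n2%:R.
    rewrite ler_pM2l; last by clear - e0; lra.
    have : 0 <= (C + 2 * G + N%:R * (1 + G)) * n3%:R.
      by rewrite mulr_ge0 //; clear - C0 G0 NG0; lra.
    by clear - n3bound T0; lra.
  by rewrite (_ : e / 2 * (4 * Cw / e * T) = 2 * Cw * T) //; field; rewrite gt_eqF.
have := lerB_dist (m%:~R + D) (m%:~R + D - coef_dot L kap w).
rewrite subKr => h1; have := close; rewrite distrC => h2.
by clear - h1 h2 far CwT; lra.
Qed.

Lemma coef_dot_neq0_of_nonresonant (N Cp a L : nat) (e : R) w kap :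
  0 < e -> nonresonant N Cp a L e w -> supported L kap ->
  (0 < coef_len L kap <= N.+1)%N -> coef_dot L kap w != 0.
Proof.
move=> e0 nr sk klen; have [klen0 _] := andP klen.
have [n [s [kap' pk]]] := peelingP sk klen0.
have L0 : (0 < L)%N by apply: leq_trans (peel_pos pk) (peel_le pk).
have := nr L kap 0; rewrite L0 leqnn /= add0r => /(_ isT sk klen isT) h.
rewrite -normr_gt0; apply: lt_le_trans h.
by rewrite divr_gt0 // exprn_gt0 // ltr0n.
Qed.

(* n1 >= n2 >= n3 are the three largest indices of kap, counted with
   multiplicity.  Since n1 <= C n2, the ratio is at most C / n3.  If n2 is
   polynomially bounded in n3, nonresonance at level n1 suffices; otherwise
   w n1 - w n2 is nearly an integer and nonresonance is used at level n3. *)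
Lemma small_divisor_estimate (N Cp a al : nat) (G C e Cw : R) :
  0 <= G -> 0 <= Cw -> 0 <= C -> 0 < e <= 1 -> (0 < a)%N -> (a * a <= al)%N ->
  N%:R * (1 + G) + 1 <= Cp%:R ->
  exists2 c : R, 0 < c & forall L w mu kap l,
  (forall n, (0 < n <= L)%N -> `|w n - n%:R| <= G) ->
  (forall n, (0 < n <= L)%N -> `|w n - n%:R - mu| <= Cw / n%:R) ->
  nonresonant N Cp a L e w -> supported L kap ->
  (0 < coef_len L kap <= N.+1)%N -> `|coef_dot L kap w| <= C -> kap l != 0 ->
  (l%:R ^+ 2 / (coef_prod L kap)%:R) ^+ al <= c * `|coef_dot L kap w|.
Proof.
move=> G0 Cw0 C0 ebnd a0 aal CpG; have /andP[e0 e1] := ebnd.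
have NG0 : 0 <= N%:R * (1 + G) by rewrite mulr_ge0 //; clear - G0; lra.
have Cwe : 0 <= 4 * Cw / e by rewrite divr_ge0 ?mulr_ge0 // ltW.
have [C1 C1E C11] : exists2 C1, C + 2 * G + N%:R * (1 + G) + 4 * Cw / e + 1 = C1 & 1 <= C1.
  by eexists; first reflexivity; clear - C0 G0 NG0 Cwe; lra.
have [H HE H1] : exists2 H, C + G + N%:R * (1 + G) + 1 = H & 1 <= H.
  by eexists; first reflexivity; clear - C0 G0 NG0 Cwe; lra.
have H0 : 0 < H by clear - H1; lra.
have C10 : 0 < C1 by clear - C11; lra.
have HC1 : 1 <= H * C1 by rewrite -[1]mulr1 ler_pM.
(* [H ^+ al] comes from the ratio n1/n2 <= H, [(H * C1) ^+ a] from trading n1 for a power of n3, and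
   2/e from half the nonresonance bound. *)
exists (2 * H ^+ al * (H * C1) ^+ a / e) => [|L w mu kap l wG wmu nr sk klen SC kl].
  by rewrite divr_gt0 // !mulr_gt0 // ?exprn_gt0 // mulr_gt0.
set S := `|coef_dot L kap w| in SC *.
have [klen0 klenN] := andP klen.
have [n1 [s1 [kap1 pk1]]] := peelingP sk klen0.
have n10 := peel_pos pk1; have n1L := peel_le pk1.
have n10R : 0 < n1%:R :> R by rewrite ltr0n.
have ln1 : (l <= n1)%N by have /andP[] := peel_supp pk1 kl.
have sk1 := peel_supp' pk1.
have p1 := coef_prod_gt0 (supported_le n1L sk1).
have p1R : 0 < (coef_prod L kap1)%:R :> R by rewrite ltr0n.
have pE := peel_prod pk1.
have X0 : 0 <= l%:R ^+ 2 / (coef_prod L kap)%:R :> R by rewrite divr_ge0 // exprn_ge0.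
have X1 : l%:R ^+ 2 / (coef_prod L kap)%:R <= n1%:R / (coef_prod L kap1)%:R :> R.
  rewrite pE natrM ler_pdivrMr ?mulr_gt0 // mulrA mulfVK ?gt_eqF // -expr2.
  by rewrite lerXn2r ?nnegrE ?ler0n // ler_nat.
have S1 : e / n1%:R ^+ a <= S.
  have := nr n1 kap 0; rewrite n10 n1L => /(_ isT (peel_supp pk1) klen isT).
  by rewrite add0r.
(* A single term is bounded by C only if its index is at most H, so everything is bounded by
   constants. *)
have [k1len|k1len] := posnP (coef_len L kap1).
  have k1z := coef_len0 (supported_le n1L sk1) k1len.
  have w1C : `|w n1| <= C.
    move: SC; rewrite /S (peel_dot w pk1) coef_dot0 // add0r normrM.
    by case: (peel_sgn pk1) => ->; rewrite ?mulrN1z ?normrN normr1 mul1r.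
  have n1H : n1%:R <= H.
    have := wG n1; rewrite n10 n1L => /(_ isT) h1.
    have := lerB_dist (n1%:R : R) (n1%:R - w n1); rewrite subKr distrC.
    rewrite (ger0_norm (ler0n _ _)) -HE; move: h1.
    by clear - w1C NG0 => h1 h2; lra.
  have p11 : (coef_prod L kap1)%:R = 1 :> R.
    by rewrite /coef_prod big1 // => i _; rewrite k1z absz0 expn0.
  apply: le_trans (_ : H ^+ al <= _).
    rewrite lerXn2r ?nnegrE ?(ltW H0) //; apply: le_trans X1 _.
    by rewrite p11 divr1.
  have : e / H ^+ a <= S.
    apply: le_trans S1; rewrite ler_pM2l // lef_pV2 ?posrE ?exprn_gt0 //.
    by rewrite lerXn2r ?nnegrE ?(ltW H0).
  rewrite ler_pdivrMr ?exprn_gt0 // => eS.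
  have S0 : 0 <= S by apply: normr_ge0.
  rewrite -(ler_pM2l e0).
  have -> : e * (2 * H ^+ al * (H * C1) ^+ a / e * S) =
     H ^+ al * (2 * ((H * C1) ^+ a * S)) by field; rewrite gt_eqF.
  rewrite mulrC ler_pM2l ?exprn_gt0 //; apply: le_trans eS _.
  have : S * H ^+ a <= S * (H * C1) ^+ a.
    by rewrite ler_wpM2l // lerXn2r ?nnegrE ?mulr_ge0 ?(ltW H0) ?(ltW C10) // ler_peMr // ltW.
  have : 0 <= S * (H * C1) ^+ a by rewrite mulr_ge0 // exprn_ge0 // ltW // mulr_gt0.
  by clear; lra.
have [n2 [s2 [kap2 pk2]]] := peelingP (supported_le n1L sk1) k1len.
have n20 := peel_pos pk2; have n2L := peel_le pk2.
have n20R : 0 < n2%:R :> R by rewrite ltr0n.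
have sk2 := peel_supp' pk2.
have p2 := coef_prod_gt0 (supported_le n2L sk2).
have [n3 [n3bnd sk3 n3p]] : exists n3, [/\ (0 < n3 <= n2)%N, supported n3 kap2 &
    (n3 <= coef_prod L kap2)%N].
  have [k2len|k2len] := posnP (coef_len L kap2).
    (* With only two indices, 1 serves as the third: the remaining support is empty and the
       remaining product is 1. *)
    have k2z := coef_len0 (supported_le n2L sk2) k2len.
    by exists 1%N; rewrite n20 p2; split => // n; rewrite k2z.
  have [n3 [s3 [kap3 pk3]]] := peelingP (supported_le n2L sk2) k2len.
  exists n3; rewrite (peel_pos pk3); split; last 2 first.
  - exact: peel_supp pk3.
  - rewrite (peel_prod pk3) leq_pmull // coef_prod_gt0 //.
    exact: supported_le (peel_le pk3) (peel_supp' pk3).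
  have : kap2 n3 != 0 by rewrite -absz_gt0 (peel_abs pk3) eqxx addn1.
  by move/sk2/andP=> [].
have /andP[n30 n32] := n3bnd.
have n30R : 0 < n3%:R :> R by rewrite ltr0n.
have n31R : 1 <= n3%:R :> R by rewrite ler1n.
(* All terms but the first are of size n2 and the whole sum is bounded, so n1 is comparable to
   n2. *)
have n12 : n1%:R <= H * n2%:R.
  have n21R : 1 <= n2%:R :> R by rewrite ler1n.
  have k1N : (coef_len L kap1 <= N)%N by move: klenN; rewrite (peel_len pk1).
  have d1 : `|coef_dot L kap1 w| <= N%:R * (1 + G) * n2%:R.
    apply: le_trans (coef_dot_le G0 n2L (peel_supp pk2) wG) _.
    by rewrite mulrA ler_wpM2r // ler_wpM2r ?ler_nat //; clear - G0; lra.
  have w1C : `|w n1| <= C + N%:R * (1 + G) * n2%:R.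
    have -> : `|w n1| = `|coef_dot L kap w - coef_dot L kap1 w|.
      rewrite (peel_dot w pk1) addrC addKr normrM.
      by case: (peel_sgn pk1) => ->; rewrite ?mulrN1z ?normrN normr1 mul1r.
    by apply: le_trans (ler_normB _ _) _; rewrite lerD.
  have := wG n1; rewrite n10 n1L => /(_ isT) h1.
  have := lerB_dist (n1%:R : R) (n1%:R - w n1); rewrite subKr distrC.
  rewrite (ger0_norm (ler0n _ _)) => h2.
  have : (C + G + 1) * 1 <= (C + G + 1) * n2%:R by rewrite ler_wpM2l //; clear - C0 G0; lra.
  by rewrite -HE; clear - h1 h2 w1C; lra.
have Xal : (l%:R ^+ 2 / (coef_prod L kap)%:R) ^+ al <= H ^+ al / n3%:R ^+ (a * a).
  apply: le_trans (_ : (H / n3%:R) ^+ al <= _).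
    rewrite lerXn2r ?nnegrE ?divr_ge0 ?(ltW H0) ?(ltW n30R) //.
    apply: le_trans X1 _; rewrite (peel_prod pk2) natrM ler_pdivrMr; last first.
      by rewrite mulr_gt0 // ltr0n.
    apply: le_trans n12 _; rewrite -mulrA ler_pM2l // mulrA ler_peMl ?(ltW n20R) //.
    by rewrite mulrC ler_pdivlMr // mul1r ler_nat.
  rewrite expr_div_n ler_pM2l ?exprn_gt0 // lef_pV2 ?posrE ?exprn_gt0 //.
  by rewrite ler_weXn2l.
apply: le_trans Xal _.
have HC1a : 1 <= (H * C1) ^+ a by rewrite exprn_ege1.
have n3aa : 0 < n3%:R ^+ (a * a) :> R by rewrite exprn_gt0.
have S0 : 0 <= S by apply: normr_ge0.
suff : e / 2 / (H * C1) ^+ a <= S * n3%:R ^+ (a * a).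
  move=> h; rewrite ler_pdivrMr //.
  have -> : 2 * H ^+ al * (H * C1) ^+ a / e * S * n3%:R ^+ (a * a) =
    H ^+ al * ((S * n3%:R ^+ (a * a)) / (e / 2 / (H * C1) ^+ a)).
    by field; rewrite !gt_eqF // exprn_gt0 // mulr_gt0.
  rewrite ler_peMr ?exprn_ge0 ?(ltW H0) // ler_pdivlMr ?mul1r //.
  by rewrite !divr_gt0 // exprn_gt0 // mulr_gt0.
have HCpos : 0 < (H * C1) ^+ a by clear - HC1a; lra.
have [n2small|n2big] := leP n2%:R (C1 * n3%:R ^+ a).
  have n1le : n1%:R ^+ a <= (H * C1) ^+ a * n3%:R ^+ (a * a).
    rewrite exprM -exprMn lerXn2r ?nnegrE ?ler0n //.
      by rewrite !mulr_ge0 ?exprn_ge0 // ltW.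
    by apply: le_trans n12 _; rewrite -mulrA ler_pM2l.
  move: S1; rewrite ler_pdivrMr ?exprn_gt0 // => S1.
  rewrite ler_pdivrMr //.
  have : S * n1%:R ^+ a <= S * ((H * C1) ^+ a * n3%:R ^+ (a * a)) by rewrite ler_wpM2l.
  by rewrite -mulrA (mulrC (n3%:R ^+ _)); move: S1; clear - e0 => *; lra.
have := small_divisor_third G0 Cw0 ebnd a0 CpG wG wmu nr SC klenN pk1 pk2 n3bnd sk3.
rewrite C1E => /(_ n2big); rewrite -/S ler_pdivrMr ?exprn_gt0 // => h.
apply: le_trans (_ : e / 2 <= _).
  by rewrite ler_pdivrMr // ler_peMr //; clear - e0; lra.
apply: le_trans h _; rewrite ler_wpM2l // ler_weXn2l // leq_pmulr //.
Qed.

End SmallDivisorEstimate.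

(** * Points where a function is small, and smallness of its derivatives *)

Section Separation.
Variable R : realType.

(* The mean value theorem on consecutive pairs of points halves their number,
   keeps them separated by g and raises the order of the derivative by one. *)
Lemma separated_derivative_bound (D : nat -> R -> R) (A B : R) :
  (forall q x, A <= x <= B -> is_derive x 1 (D q) (D q.+1 x)) ->
  forall q j (x : nat -> R) (g eps : R), 0 < g ->
  (forall i, (i < 2 ^ q)%N -> A <= x i <= B) ->
  (forall i, (i.+1 < 2 ^ q)%N -> x i + g <= x i.+1) ->
  (forall i, (i < 2 ^ q)%N -> `|D j (x i)| <= eps) ->
  exists2 xi, A <= xi <= B & `|D (j + q)%N xi| <= eps * (2 / g) ^+ q.
Proof.
move=> dD; elim=> [|q IHq] j x g eps g0 xAB xg xeps.
  by exists (x 0%N); rewrite ?xAB // addn0 expr0 mulr1 xeps.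
have idx i : (i < 2 ^ q)%N -> (i.*2.+1 < 2 ^ q.+1)%N.
  by rewrite expnS mul2n -ltn_double; lia.
have [y yP] : {y : nat -> R & forall i, (i < 2 ^ q)%N ->
    (x i.*2 <= y i <= x i.*2.+1) /\ `|D j.+1 (y i)| <= eps * (2 / g)}.
  apply: (@choice _ _ (fun i t => (i < 2 ^ q)%N ->
    (x i.*2 <= t <= x i.*2.+1) /\ `|D j.+1 t| <= eps * (2 / g))) => i.
  have [iq|] := boolP (i < 2 ^ q)%N; last by exists 0.
  have h1 := idx _ iq; have h0 := ltnW h1.
  have gap := xg _ h1.
  have /andP[xA _] := xAB _ h0; have /andP[_ xB] := xAB _ h1.
  have le01 : x i.*2 <= x i.*2.+1 by clear - gap g0; lra.
  have inAB t : t \in `[x i.*2, x i.*2.+1] -> A <= t <= B.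
    by rewrite in_itv /= => /andP[t1 t2]; rewrite (le_trans xA) // (le_trans t2).
  have [c cx cE] : exists2 c, c \in `[x i.*2, x i.*2.+1] &
      D j (x i.*2.+1) - D j (x i.*2) = D j.+1 c * (x i.*2.+1 - x i.*2).
    apply: MVT_segment => // [t /subset_itv_oo_cc/inAB|]; first exact: dD.
    apply: derivable_within_continuous => t /inAB/(dD j t) dt.
    exact: (@ex_derive _ _ _ _ _ _ _ dt).
  exists c => _; split; first by move: cx; rewrite in_itv.
  rewrite mulrA ler_pdivlMr //.
  apply: le_trans (_ : `|D j.+1 c * (x i.*2.+1 - x i.*2)| <= _).
    rewrite normrM ler_wpM2l // ger0_norm; clear - gap g0; lra.
  rewrite -cE; apply: le_trans (ler_normB _ _) _.
  have := xeps _ h1; have := xeps _ h0; clear; lra.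
have -> : eps * (2 / g) ^+ q.+1 = eps * (2 / g) * (2 / g) ^+ q by rewrite exprS mulrA.
rewrite -addSnnS; apply: (IHq j.+1 y g) => // i iq.
- have [/andP[y1 y2] _] := yP _ iq; have h1 := idx _ iq.
  have /andP[xA _] := xAB _ (ltnW h1); have /andP[_ xB] := xAB _ h1.
  by rewrite (le_trans xA) // (le_trans y2).
- have [/andP[_ y1] _] := yP _ (ltnW iq); have [/andP[y2 _] _] := yP _ iq.
  apply: le_trans y2; rewrite doubleS; apply: le_trans (_ : x i.*2.+1 + g <= _).
    by rewrite lerD2r.
  by apply: xg; have := idx _ iq; rewrite doubleS => /ltnW.
- by have [] := yP _ iq.
Qed.

(** Greedy choice: a point of E within g of the infimum is taken. What lies less than g above it
    fits in an interval of length 2g, and the search continues in the rest. *)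
Lemma separated_points (k : nat) (E : set R) (a b g : R) : 0 < g ->
  measurable E -> E `<=` `[a, b] ->
  (exists x : nat -> R, (forall i, (i < k.+1)%N -> E (x i)) /\
     (forall i, (i < k)%N -> x i + g <= x i.+1)) \/
  (lebesgue_measure E <= (k%:R * (2 * g))%:E)%E.
Proof.
move=> g0; elim: k E => [|k IHk] E mE Eab.
  have [->|/set0P[x Ex]] := eqVneq E set0; last by left; exists (fun=> x).
  by right; rewrite measure0 mul0r.
have [->|/set0P Ene] := eqVneq E set0.
  by right; rewrite measure0 lee_fin !mulr_ge0 // ltW.
have hiE : has_inf E.
  by split => //; exists a => x /Eab /=; rewrite in_itv => /andP[].
have [x Ex xinf] := inf_adherent g0 hiE.
pose E' := E `&` `[x + g, +oo[.
have mE' : measurable E' by apply: measurableI.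
have E'ab : E' `<=` `[a, b] by move=> t [/Eab].
have [[y [yE yg]]|mes] := IHk E' mE' E'ab.
  left; exists (fun i => if i is i'.+1 then y i' else x); split.
    by case=> [//|i]; rewrite ltnS => /yE[].
  case=> [_|i]; last by rewrite ltnS => /yg.
  by have [_] := yE 0%N isT; rewrite /= in_itv /= andbT.
right; have EU : E `<=` `[inf E, inf E + 2 * g] `|` E'.
  move=> t Et; have [tx|tx] := leP (x + g) t.
    by right; split => //=; rewrite in_itv /= tx.
  left; rewrite /= in_itv /=; apply/andP; split; first by apply: ge_inf => //; case: hiE.
  by clear - tx xinf; lra.
apply: le_trans (_ : (lebesgue_measure (`[inf E, (inf E + 2 * g)%R] `|` E') <= _)%E).
  by apply: le_measure => //; rewrite inE //; apply: measurableU.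
have hU : (lebesgue_measure (`[inf E, (inf E + 2 * g)%R] `|` E') <=
    lebesgue_measure `[inf E, (inf E + 2 * g)%R] + lebesgue_measure E')%E.
  exact: measureU2.
apply: le_trans hU _.
rewrite lebesgue_measure_itv /= lte_fin ltrDl mulr_gt0 //.
have -> : (k.+1%:R * (2 * g))%:E = ((2 * g)%:E + (k%:R * (2 * g))%:E)%E.
  by rewrite -EFinD -natr1 mulrDl mul1r addrC.
by apply: leeD => //; rewrite -EFinB lee_fin addrAC subrr add0r.
Qed.

End Separation.

(** * Derivatives of the square roots *)

Section SqrtFamily.
Variable R : realType.
Implicit Types (kap : nat -> int) (M n q : nat) (lam : R).

(* the q-th derivative of sig |-> sqrt (n (n + 2 lam sig)) is
   lam^q sqrt_coef q * sqrt_term lam n q sig *)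
Definition sqrt_term lam n q (sig : R) : R :=
  Num.sqrt (n%:R * (n%:R + 2 * lam * sig)) * (n%:R + 2 * lam * sig) ^- q.

Fixpoint sqrt_coef q : R := if q is p.+1 then sqrt_coef p * (1 - 2 * p%:R) else 1.

(** Every factor 1 - 2p is an odd integer. *)
Lemma sqrt_coef_ge1 q : 1 <= `|sqrt_coef q|.
Proof.
elim: q => [|q IHq] /=; first by rewrite normr1.
rewrite normrM; apply: (@mulr_ege1 _ _ `|_|) => //.
case: q {IHq} => [|q]; first by rewrite mulr0 subr0 normr1.
rewrite distrC ger0_norm; last by rewrite subr_ge0 -natrM ler1n.
by have : (1 : R) <= q.+1%:R; [rewrite ler1n | lra].
Qed.

Lemma is_derive_sqrt_term lam n q (sig : R) : (0 < n)%N -> 0 < n%:R + 2 * lam * sig ->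
  is_derive sig 1 (sqrt_term lam n q)
    (lam * (1 - 2 * q%:R) * sqrt_term lam n q.+1 sig).
Proof.
move=> n0 om0; have n0R : 0 < n%:R :> R by rewrite ltr0n.
pose om (s : R) := n%:R + 2 * lam * s.
have dom : is_derive sig 1 om (2 * lam).
  by apply: is_derive_eq; rewrite /GRing.scale /=; ring.
have nom0 : 0 < n%:R * om sig by rewrite mulr_gt0.
have dnom : is_derive sig 1 (fun s => n%:R * om s) (n%:R * (2 * lam)).
  by apply: is_derive_eq; rewrite /GRing.scale /=; ring.
have dsq : is_derive sig 1 (fun s => Num.sqrt (n%:R * om s))
    ((2 * Num.sqrt (n%:R * om sig))^-1 * (n%:R * (2 * lam))).
  exact: (@is_derive1_comp _ Num.sqrt (fun s => n%:R * om s) _ _ _ (is_derive1_sqrt nom0) dnom).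
have dpow : is_derive sig 1 (fun s => om s ^- q) (- (q%:R * (2 * lam)) * om sig ^- q.+1).
  have dx := is_deriveX q dom; rewrite exprfctE in dx.
  have omq : om sig ^+ q != 0 by rewrite expf_neq0 // gt_eqF.
  have := @is_deriveV _ (fun s => om s ^+ q) sig _ 1 omq dx.
  move=> H; apply: is_derive_eq H _; rewrite /GRing.scale /=.
  have omn : om sig != 0 by rewrite gt_eqF.
  case: q {dx} omq => [|q] omq; first by rewrite !mul0r mulr0 oppr0 mul0r.
  by rewrite /= !exprS; field; rewrite omn expf_neq0.
have H := is_deriveM dsq dpow; apply: is_derive_eq H _; rewrite /GRing.scale /= /sqrt_term.
rewrite -/(om sig).
have sq0 : 0 < Num.sqrt (n%:R * om sig) by rewrite sqrtr_gt0.
have sqE : Num.sqrt (n%:R * om sig) ^+ 2 = n%:R * om sig by rewrite sqr_sqrtr // ltW.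
have nE : n%:R = Num.sqrt (n%:R * om sig) ^+ 2 / om sig.
  by rewrite sqE mulfK // gt_eqF.
set S := Num.sqrt _ in sq0 sqE nE *.
rewrite [X in _ + _ * (_ * (X * _))]nE exprS.
have oq0 : om sig ^+ q != 0 by rewrite expf_neq0 // gt_eqF.
by field; rewrite oq0 !gt_eqF.
Qed.

(** The bound must not depend on [n]. The square root is at most o/k with o = n + 2 lam sig, and one
    of the q >= 1 inverse powers of o absorbs this growth. *)
Lemma sqrt_term_bound lam n q (sig k : R) : (0 < n)%N -> 0 < k <= 1 ->
  k * n%:R <= n%:R + 2 * lam * sig -> (0 < q)%N ->
  0 <= sqrt_term lam n q sig <= k ^- q.
Proof.
move=> n0 /andP[k0 k1] om q0; have n1R : 1 <= n%:R :> R by rewrite ler1n.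
rewrite /sqrt_term; set o := _ + _ in om *.
have ko : k <= o by apply: le_trans om; rewrite ler_peMr // ltW.
have o0 : 0 < o by apply: lt_le_trans ko.
rewrite mulr_ge0 ?sqrtr_ge0 ?invr_ge0 ?exprn_ge0 ?(ltW o0) //=.
apply: le_trans (_ : o / k * o ^- q <= _).
  rewrite ler_wpM2r ?invr_ge0 ?exprn_ge0 ?(ltW o0) //.
  rewrite -[leRHS]ger0_norm ?divr_ge0 ?(ltW o0) ?(ltW k0) // -sqrtr_sqr ler_sqrt ?sqr_ge0 //.
  have -> : (o / k) ^+ 2 = o / k ^+ 2 * o by field; rewrite gt_eqF.
  rewrite ler_pM2r // ler_pdivlMr ?exprn_gt0 //; apply: le_trans om.
  rewrite expr2 mulrA mulrC ler_pM2l // ler_piMr //; clear - n1R; lra.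
case: q q0 => // q _.
have -> : o / k * o ^- q.+1 = k^-1 * o ^- q.
  by rewrite exprS; field; rewrite ?expf_neq0 ?gt_eqF.
rewrite exprS invfM ler_pM2l ?invr_gt0 // lef_pV2 ?posrE ?exprn_gt0 //.
by rewrite lerXn2r ?nnegrE ?(ltW o0) ?(ltW k0).
Qed.

End SqrtFamily.

(** * Vandermonde argument for the moments in 1 / (n + 2 lam sig) *)

Section Moments.
Variable R : realType.
Implicit Types (kap : nat -> int) (M n q : nat) (lam : R).

(** Replaces a determinant: consecutive moments are combined into one weighted by a polynomial with
    prescribed roots, at the price of a factor 1 + X per root. *)
Lemma divided_moment_le M (c x : nat -> R) (X eta : R) (s : seq R) q0 :
  0 <= X -> (forall y, y \in s -> `|y| <= X) ->
  (forall q, (q0 <= q <= q0 + size s)%N -> `|\sum_(n < M.+1) c n * x n ^+ q| <= eta) ->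
  `|\sum_(n < M.+1) c n * x n ^+ q0 * \prod_(y <- s) (x n - y)| <= eta * (1 + X) ^+ size s.
Proof.
move=> X0; elim: s q0 => [|y s IHs] q0 sX mom.
  rewrite expr0 mulr1; have := mom q0; rewrite leqnn addn0 leqnn => /(_ isT).
  by under [X in _ -> `|X| <= _]eq_bigr => n _ do rewrite big_nil mulr1.
have sX' z : z \in s -> `|z| <= X by move=> zs; apply: sX; rewrite inE zs orbT.
have yX : `|y| <= X by apply: sX; rewrite inE eqxx.
have h0 := IHs q0 sX'; have h1 := IHs q0.+1 sX'.
have -> : \sum_(n < M.+1) c n * x n ^+ q0 * \prod_(j <- y :: s) (x n - j) =
   \sum_(n < M.+1) c n * x n ^+ q0.+1 * \prod_(j <- s) (x n - j) -
   y * \sum_(n < M.+1) c n * x n ^+ q0 * \prod_(j <- s) (x n - j).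
  rewrite mulr_sumr -sumrB; apply: eq_bigr => n _.
  by rewrite big_cons exprS; ring.
apply: le_trans (ler_normB _ _) _; rewrite /= exprS mulrCA mulrDl mul1r lerD //.
  by apply: h1 => q /andP[q1 q2]; apply: mom; rewrite ltnW // addnS -addSn.
rewrite normrM ler_pM //; apply: h0 => q /andP[q1 q2]; apply: mom.
by rewrite q1 addnS ltnW // ltnS.
Qed.

Lemma prodr_ge_expr (I : eqType) (s : seq I) (F : I -> R) (t : R) N : 0 <= t <= 1 ->
  (size s <= N)%N -> (forall i, i \in s -> t <= F i) -> t ^+ N <= \prod_(i <- s) F i.
Proof.
move=> /andP[t0 t1] sN tF; apply: le_trans (_ : t ^+ size s <= _).
  by rewrite ler_wiXn2l.
elim: s {sN} tF => [|i s IHs] tF; first by rewrite big_nil expr0.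
rewrite big_cons exprS ler_pM ?exprn_ge0 //; first by rewrite tF // inE eqxx.
by apply: IHs => j js; rewrite tF // inE js orbT.
Qed.

Lemma count_support_le M kap : (count (fun i => kap i != 0) (iota 0 M.+1) <= coef_len M kap)%N.
Proof.
rewrite /coef_len -(big_mkord xpredT (fun i => `|kap i|%N)) -sum1_count.
rewrite /index_iota subn0 big_mkcond /= leq_sum // => i _.
by case: ifP => //; rewrite absz_gt0.
Qed.

(** The weight at the selected index gives k and three powers of 1 + 2B, the at most N node
    differences give 2N more, and (1 + 1/k)^N is the price of the divided moment. *)
Definition moment_const (N : nat) (k B : R) : R :=
  k / ((1 + 2 * B) ^+ (3 + 2 * N) * (1 + k^-1) ^+ N).

Lemma moment_const_gt0 N (k B : R) : 0 < k -> 0 <= B -> 0 < moment_const N k B.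
Proof.
move=> k0 B0; rewrite divr_gt0 // mulr_gt0 // exprn_gt0 //; first by clear - B0; lra.
by rewrite addr_gt0 // invr_gt0.
Qed.

(* The numbers 1 / (n + 2 lam sig) are pairwise separated by a multiple of
   1 / M^2, so a Vandermonde argument bounds the moments from below. *)
Lemma moment_lower_bound N lam M kap (sig k B eta : R) :
  0 < k <= 1 -> 0 <= B -> (forall n, (0 < n)%N -> k * n%:R <= n%:R + 2 * lam * sig) ->
  `|lam * sig| <= B -> supported M kap -> (0 < coef_len M kap <= N.+1)%N ->
  (forall q, (3 <= q <= N + 3)%N ->
     `|coef_dot M kap (fun n => sqrt_term lam n q sig)| <= eta) ->
  moment_const N k B / M%:R ^+ (2 * N + 2) <= eta.
Proof.
move=> kbnd B0 disp sigB sk klen mom; have /andP[k0 k1] := kbnd.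
have [klen0 klenN] := andP klen.
have [n0 [s0 [kap' pk]]] := peelingP sk klen0.
have n0pos := peel_pos pk; have n0M := peel_le pk.
have kn0 : kap n0 != 0 by rewrite -absz_gt0 (peel_abs pk) eqxx addn1.
have M1 : 1 <= M%:R :> R by rewrite ler1n (leq_trans n0pos).
have M0 : 0 < M%:R :> R by clear - M1; lra.
pose x n : R := (n%:R + 2 * lam * sig)^-1.
pose v n : R := Num.sqrt (n%:R * (n%:R + 2 * lam * sig)).
pose c n : R := (kap n)%:~R * v n.
pose idx := [seq i <- iota 0 M.+1 | (kap i != 0) && (i != n0)].
have idxP i : i \in idx -> [/\ (0 < i)%N, (i <= M)%N & i != n0].
  by rewrite mem_filter => /andP[/andP[/sk/andP[-> ->] ->] _].
have sN : (size idx <= N)%N.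
  rewrite -ltnS; apply: leq_trans klenN; apply: leq_trans (count_support_le _ _).
  rewrite -size_filter; apply: (@uniq_leq_size _ (n0 :: idx)).
    by rewrite /= filter_uniq ?iota_uniq // mem_filter eqxx andbF.
  move=> i; rewrite inE !mem_filter !mem_iota => /predU1P[->|].
    by rewrite kn0 /= add0n ltnS.
  by move=> /andP[/andP[-> _]].
have om0 n : (0 < n)%N -> 0 < n%:R + 2 * lam * sig.
  by move=> n0'; apply: lt_le_trans (disp _ n0'); rewrite mulr_gt0 // ltr0n.
have x0 n : (0 < n)%N -> 0 < x n by move=> /om0; rewrite invr_gt0.
have xk n : (0 < n)%N -> x n <= k^-1.
  move=> np; rewrite lef_pV2 ?posrE ?om0 //; apply: le_trans (disp _ np).
  by rewrite ler_peMr ?(ltW k0) // ler1n.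
have B1 : 1 <= 1 + 2 * B by clear - B0; lra.
have xM n : (0 < n <= M)%N -> ((1 + 2 * B) * M%:R)^-1 <= x n.
  move=> /andP[np nM]; rewrite lef_pV2 ?posrE ?om0 ?mulr_gt0 //; last by clear - B1; lra.
  have h1 : n%:R <= M%:R :> R by rewrite ler_nat.
  have h2 : lam * sig <= B by apply: le_trans sigB; rewrite ler_norm.
  have h3 : B * 1 <= B * M%:R by rewrite ler_wpM2l.
  by clear - h1 h2 h3; lra.
have := @divided_moment_le M c x k^-1 eta [seq x i | i <- idx] 3.
rewrite size_map invr_ge0 (ltW k0) => /(_ isT) H.
have {}H : `|\sum_(n < M.+1) c n * x n ^+ 3 * \prod_(y <- [seq x i | i <- idx]) (x n - y)|
    <= eta * (1 + k^-1) ^+ size idx.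
  apply: H => [y /mapP[i /idxP[i0 _ _] ->]|q /andP[q3 qN]].
    by rewrite gtr0_norm ?x0 // xk.
  have qbnd : (3 <= q <= N + 3)%N by rewrite q3 /= (leq_trans qN) // addnC leq_add2r.
  have := mom q qbnd.
  have -> : coef_dot M kap (fun n => sqrt_term lam n q sig) = \sum_(n < M.+1) c n * x n ^+ q.
    by apply: eq_bigr => n _; rewrite /c /sqrt_term /x /v mulrA exprVn.
  by [].
(* The roots are the nodes of all other indices in the support, so a single term survives. *)
have sumE : \sum_(n < M.+1) c n * x n ^+ 3 * \prod_(y <- [seq x i | i <- idx]) (x n - y)
    = c n0 * x n0 ^+ 3 * \prod_(i <- idx) (x n0 - x i).
  rewrite (bigD1 (Ordinal (n0M : (n0 < M.+1)%N))) //= big_map -[RHS]addr0; congr (_ + _).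
  apply: big1 => n nn0.
  have [kn|kn] := eqVneq (kap n) 0; first by rewrite /c kn !mul0r.
  rewrite (_ : \prod_(y <- _) _ = 0) ?mulr0 //; apply/eqP.
  rewrite prodf_seq_eq0; apply/hasP; exists (x n); last by rewrite subrr eqxx.
  by apply: map_f; rewrite mem_filter kn mem_iota /= add0n ltn_ord andbT.
rewrite sumE normrM (normrM (c n0)) normr_prod in H.
(* A difference of nodes is i - n0 times the product of the two nodes; the integer is nonzero and
   each node is at least 1/((1 + 2B) M). *)
pose t : R := ((1 + 2 * B) * M%:R) ^- 2.
have BM1 : 1 <= (1 + 2 * B) * M%:R by apply: mulr_ege1.
have BM0 : 0 < (1 + 2 * B) * M%:R by clear - BM1; lra.
have t01 : 0 <= t <= 1.
  by rewrite invr_ge0 exprn_ge0 ?(ltW BM0) //= invf_le1 ?exprn_gt0 // exprn_ege1.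
have prodge : t ^+ N <= \prod_(i <- idx) `|x n0 - x i|.
  apply: prodr_ge_expr => // i /idxP[i0 iM in0].
  have -> : x n0 - x i = (i%:R - n0%:R) * (x n0 * x i).
    rewrite /x; field; rewrite !gt_eqF ?om0 //.
  rewrite normrM (gtr0_norm (mulr_gt0 (x0 _ n0pos) (x0 _ i0))).
  rewrite /t expr2 invfM -[leLHS]mul1r ler_pM // ?mulr_ge0 ?invr_ge0 ?(ltW BM0) //.
    have -> : i%:R - n0%:R = (i%:Z - n0%:Z)%:~R :> R by rewrite intrB.
    rewrite -intr_norm (ler_int R 1); clear - in0; lia.
  by rewrite ler_pM ?invr_ge0 ?(ltW BM0) // xM ?n0pos ?i0.
have kap1 : 1 <= `|(kap n0)%:~R| :> R.
  by rewrite -intr_norm (ler_int R 1); clear - kn0; lia.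
have n0R : 1 <= n0%:R :> R by rewrite ler1n.
have vge : k * n0%:R <= v n0.
  rewrite -[leLHS]ger0_norm ?mulr_ge0 ?(ltW k0) // -sqrtr_sqr ler_sqrt; last first.
    by rewrite mulr_ge0 // ltW // om0.
  apply: le_trans (_ : n0%:R * (k * n0%:R) <= _).
    rewrite expr2 ler_wpM2r ?mulr_ge0 ?(ltW k0) //.
    by rewrite ler_piMl.
  by rewrite ler_wpM2l // disp.
have xn0 : ((1 + 2 * B) * n0%:R)^-1 <= x n0.
  rewrite lef_pV2 ?posrE ?om0 ?mulr_gt0 ?ltr0n //; last by clear - B1; lra.
  have h2 : lam * sig <= B by apply: le_trans sigB; rewrite ler_norm.
  have h3 : B * 1 <= B * n0%:R by rewrite ler_wpM2l.
  by clear - h2 h3; lra.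
have vx : k / ((1 + 2 * B) ^+ 3 * M%:R ^+ 2) <= v n0 * x n0 ^+ 3.
  apply: le_trans (_ : k * n0%:R * ((1 + 2 * B) * n0%:R)^-1 ^+ 3 <= _); last first.
    have Bn0 : 0 <= ((1 + 2 * B) * n0%:R)^-1.
      by rewrite invr_ge0 mulr_ge0 //; clear - B1; lra.
    apply: ler_pM => //; first by rewrite mulr_ge0 // ltW.
      by rewrite exprn_ge0.
    by rewrite lerXn2r // nnegrE ltW // x0.
  have n00 : 0 < n0%:R :> R by clear - n0R; lra.
  have B10 : 0 < 1 + 2 * B by clear - B1; lra.
  have -> : k * n0%:R * ((1 + 2 * B) * n0%:R)^-1 ^+ 3 =
     k / ((1 + 2 * B) ^+ 3 * n0%:R ^+ 2) by field; rewrite !gt_eqF.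
  rewrite ler_pM2l // lef_pV2 ?posrE ?mulr_gt0 ?exprn_gt0 // ler_pM2l ?exprn_gt0 //.
  by rewrite lerXn2r ?nnegrE ?ler0n // ler_nat.
have K1 : 1 <= 1 + k^-1 by rewrite lerDl invr_ge0 ltW.
have K0 : 0 < 1 + k^-1 by clear - K1; lra.
have eta0 : 0 <= eta.
  by apply: le_trans (normr_ge0 _) (mom 3%N _); rewrite leq_addl.
have Keta : eta * (1 + k^-1) ^+ size idx <= eta * (1 + k^-1) ^+ N.
  by rewrite ler_wpM2l // ler_weXn2l.
have : k / ((1 + 2 * B) ^+ 3 * M%:R ^+ 2) * t ^+ N <= eta * (1 + k^-1) ^+ N.
  apply: le_trans Keta; apply: le_trans H; rewrite ler_pM //.
  - by rewrite divr_ge0 ?(ltW k0) // mulr_ge0 ?exprn_ge0 //; clear - B1; lra.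
  - by rewrite exprn_ge0 //; case/andP: t01.
  rewrite (ger0_norm (exprn_ge0 _ (ltW (x0 _ n0pos)))) (normrM _ (v n0)) -mulrA.
  apply: le_trans vx _; rewrite (ger0_norm (sqrtr_ge0 _)) ler_peMl //.
  by apply: mulr_ge0; [exact: sqrtr_ge0 | apply: exprn_ge0; apply/ltW/x0].
have B10 : 0 < 1 + 2 * B by clear - B1; lra.
rewrite -ler_pdivrMr ?exprn_gt0 //; apply: le_trans.
rewrite le_eqVlt; apply/orP; left; apply/eqP.
rewrite /moment_const /t exprVn -exprM !exprD !exprMn.
have Kn : (1 + k^-1) ^+ N != 0 by rewrite expf_neq0 // gt_eqF.
move: Kn; set kk := (1 + _) ^+ N => kn.
by field; rewrite kn !expf_neq0 ?gt_eqF.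
Qed.

End Moments.

(** * Near-resonances at many separated points contradict the moment bound *)

Section LevelSets.
Variable R : realType.
Implicit Types (kap : nat -> int) (M n q : nat) (lam m A sig : R).

Definition quad_deriv m A q sig : R :=
  match q with
  | 0 => m + A * sig ^+ 2
  | 1 => 2 * A * sig
  | 2 => 2 * A
  | _ => 0
  end.

(** The variable is sig = rho^2, so mu = lam sig and mu^2 = sig^2. [A] will be the combination of
    the [shift_coef], which is constant in sig for fixed h. *)
Definition phase_deriv lam M kap m A q sig : R :=
  lam ^+ q * sqrt_coef R q * coef_dot M kap (fun n => sqrt_term lam n q sig)
  + quad_deriv m A q sig.

Lemma is_derive_quad m A q sig :
  is_derive sig 1 (quad_deriv m A q) (quad_deriv m A q.+1 sig).
Proof.
case: q => [|[|[|q]]]; last 2 first.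
- exact: is_derive_cst.
- exact: is_derive_cst.
- have H : is_derive sig 1 (fun s : R => m + A * s ^+ 2) (2 * A * sig).
    by apply: is_derive_eq; rewrite /GRing.scale /=; ring.
  exact: H.
- have H : is_derive sig 1 (fun s : R => 2 * A * s) (2 * A).
    by apply: is_derive_eq; rewrite /GRing.scale /=; ring.
  exact: H.
Qed.

Lemma is_derive_phase lam M kap m A q sig : supported M kap ->
  (forall n, (0 < n)%N -> 0 < n%:R + 2 * lam * sig) ->
  is_derive sig 1 (phase_deriv lam M kap m A q) (phase_deriv lam M kap m A q.+1 sig).
Proof.
move=> sk om0.
have dterm (n : 'I_M.+1) : is_derive sig 1
    (fun s => (kap n)%:~R * sqrt_term lam n q s)
    ((kap n)%:~R * (lam * (1 - 2 * q%:R) * sqrt_term lam n q.+1 sig)).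
  have [->|/sk/andP[n0 _]] := eqVneq (kap n) 0.
    rewrite mul0r (_ : (fun s => _) = cst 0); first exact: is_derive_cst.
    by apply/funext => s; rewrite mul0r.
  have := is_derive_sqrt_term q n0 (om0 _ n0); move=> H.
  by have := is_deriveZ ((kap n)%:~R : R) H.
have dsum := is_derive_sum dterm; rewrite fct_sumE in dsum.
have dsum' := is_deriveZ (lam ^+ q * sqrt_coef R q) dsum.
have H := is_deriveD dsum' (is_derive_quad m A q sig).
apply: is_derive_eq H _.
rewrite /phase_deriv /coef_dot /GRing.scale /=; congr (_ + _).
rewrite !mulr_sumr; apply: eq_bigr => n _; rewrite exprS; ring.
Qed.

Lemma quad_deriv_ge3 m A q sig : (3 <= q)%N -> quad_deriv m A q sig = 0.
Proof. by case: q => [|[|[|q]]]. Qed.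

(** A sum in place of a maximum. It reaches order N + 4, which controls the variation of the
    derivative of order N + 3. *)
Definition lipschitz_const (N : nat) (k : R) : R :=
  \sum_(q < N + 5) (`|sqrt_coef R q| * (N.+1%:R * k ^- q)).

Lemma phase_deriv_bound N lam M kap m A q sig (k : R) : `|lam| = 1 -> 0 < k <= 1 ->
  (forall n, (0 < n)%N -> k * n%:R <= n%:R + 2 * lam * sig) ->
  supported M kap -> (coef_len M kap <= N.+1)%N -> (3 <= q < N + 5)%N ->
  `|phase_deriv lam M kap m A q sig| <= lipschitz_const N k.
Proof.
move=> lam1 kbnd disp sk klen /andP[q3 qN]; have /andP[k0 k1] := kbnd.
rewrite /phase_deriv quad_deriv_ge3 // addr0 normrM (normrM (lam ^+ q)) normrX lam1 expr1n mul1r.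
have kq q' : 0 <= k ^- q' by rewrite invr_ge0 exprn_ge0 // ltW.
apply: le_trans (_ : `|sqrt_coef R q| * (N.+1%:R * k ^- q) <= _); last first.
  rewrite /lipschitz_const (bigD1 (Ordinal qN)) //= lerDl sumr_ge0 // => i _.
  by rewrite !mulr_ge0.
rewrite ler_wpM2l //; apply: le_trans (_ : (coef_len M kap)%:R * k ^- q <= _); last first.
  by rewrite ler_wpM2r // ler_nat.
rewrite /coef_dot /coef_len natr_sum mulr_suml.
apply: le_trans (ler_norm_sum _ _ _) (ler_sum _ _) => n _.
have [->|kn] := eqVneq (kap n) 0; first by rewrite absz0 !mul0r normr0.
have /andP[n0 _] := sk _ kn.
rewrite normrM natr_absz intr_norm ler_wpM2l //.
have /andP[s0 s1] : 0 <= sqrt_term lam n q sig <= k ^- q.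
  by apply: sqrt_term_bound => //; [exact: disp | exact: leq_trans q3].
by rewrite ger0_norm.
Qed.

Lemma lipschitz_const_ge0 N (k : R) : 0 < k -> 0 <= lipschitz_const N k.
Proof.
move=> k0; apply: sumr_ge0 => i _; rewrite !mulr_ge0 // invr_ge0 exprn_ge0 // ltW //.
Qed.

(** For each order q the repeated mean value theorem yields its own point where the derivative is
    small. The Lipschitz bound moves all of them to the common point [x 0], where the moment bound
    needs them together; this costs the term in b - a. *)
Lemma phase_level_separation N lam M kap m A (k B a b g eps : R) (x : nat -> R) :
  `|lam| = 1 -> 0 < k <= 1 -> 0 <= B ->
  (forall sig n, a <= sig <= b -> (0 < n)%N -> k * n%:R <= n%:R + 2 * lam * sig) ->
  (forall sig, a <= sig <= b -> `|sig| <= B) ->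
  supported M kap -> (0 < coef_len M kap <= N.+1)%N ->
  0 < g <= 2 ->
  (forall i, (i < 2 ^ (N + 3))%N -> a <= x i <= b) ->
  (forall i, (i.+1 < 2 ^ (N + 3))%N -> x i + g <= x i.+1) ->
  (forall i, (i < 2 ^ (N + 3))%N -> `|phase_deriv lam M kap m A 0 (x i)| <= eps) ->
  moment_const N k B / M%:R ^+ (2 * N + 2)
    <= eps * (2 / g) ^+ (N + 3) + lipschitz_const N k * (b - a).
Proof.
move=> lam1 kbnd B0 disp sigB sk klen /andP[g0 g2] xab xg xeps; have /andP[k0 k1] := kbnd.
have [_ klenN] := andP klen.
have dD q sig : a <= sig <= b ->
    is_derive sig 1 (phase_deriv lam M kap m A q) (phase_deriv lam M kap m A q.+1 sig).
  move=> sab; apply: is_derive_phase => // n n0; apply: lt_le_trans (disp _ _ sab n0).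
  by rewrite mulr_gt0 // ltr0n.
have x0ab := xab 0%N (expn_gt0 2 _).
have eps0 : 0 <= eps by apply: le_trans (xeps 0%N _) => //; rewrite expn_gt0.
have ab : 0 <= b - a by rewrite subr_ge0; case/andP: x0ab => /le_trans; apply.
have L0 := lipschitz_const_ge0 N k0.
apply: (@moment_lower_bound R N lam M kap (x 0%N) k B) => //.
- by move=> n; apply: disp.
- by rewrite normrM lam1 mul1r sigB.
move=> q /andP[q3 qN].
have q2 : (2 ^ q <= 2 ^ (N + 3))%N by rewrite leq_exp2l.
have [xi xiab xiE] : exists2 xi, a <= xi <= b &
    `|phase_deriv lam M kap m A (0 + q)%N xi| <= eps * (2 / g) ^+ q.
  apply: (separated_derivative_bound dD (x := x)) => // i iq.
  - by apply: xab; apply: leq_trans q2.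
  - by apply: xg; apply: leq_trans q2.
  - by apply: xeps; apply: leq_trans q2.
have g1 : 1 <= 2 / g by rewrite ler_pdivlMr // mul1r.
have qle : eps * (2 / g) ^+ q <= eps * (2 / g) ^+ (N + 3) by rewrite ler_wpM2l // ler_weXn2l.
rewrite add0n in xiE.
have lip s t : a <= s <= b -> a <= t <= b -> s <= t ->
    `|phase_deriv lam M kap m A q t - phase_deriv lam M kap m A q s|
      <= lipschitz_const N k * (b - a).
  move=> /andP[sa sb] /andP[ta tb] st.
  have inab u : u \in `[s, t] -> a <= u <= b.
    by rewrite in_itv /= => /andP[u1 u2]; rewrite (le_trans sa) // (le_trans u2).
  have [c cx ->] : exists2 c, c \in `[s, t] &
      phase_deriv lam M kap m A q t - phase_deriv lam M kap m A q s =
      phase_deriv lam M kap m A q.+1 c * (t - s).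
    apply: MVT_segment => // [u /subset_itv_oo_cc/inab|]; first exact: dD.
    apply: derivable_within_continuous => u /inab/(dD q u) du.
    exact: (@ex_derive _ _ _ _ _ _ _ du).
  rewrite normrM ler_pM //.
    apply: phase_deriv_bound => //; first by move=> n; apply: disp; apply: inab.
    by clear - q3 qN; lia.
  by rewrite ger0_norm; clear - st sa tb; lra.
have close : `|phase_deriv lam M kap m A q (x 0%N)| <=
    eps * (2 / g) ^+ (N + 3) + lipschitz_const N k * (b - a).
  have : `|phase_deriv lam M kap m A q (x 0%N) - phase_deriv lam M kap m A q xi|
      <= lipschitz_const N k * (b - a).
    have [le1|/ltW le1] := leP xi (x 0%N); first exact: lip.
    by rewrite distrC; apply: lip.
  have := lerB_dist (phase_deriv lam M kap m A q (x 0%N)) (phase_deriv lam M kap m A q xi).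
  by clear - xiE qle; lra.
apply: le_trans close.
rewrite /phase_deriv quad_deriv_ge3 // addr0 !normrM normrX lam1 expr1n mul1r.
by rewrite ler_peMl // sqrt_coef_ge1.
Qed.

End LevelSets.

(** * Measure of unions and of sets with small slices *)

Section MeasureTools.
Variable R : realType.

(** The inverse is x times the power (x^2)^(-1), an identity that also respects the convention 0^-1
    = 0. *)
Lemma measurable_invr : measurable_fun [set: R] (@GRing.inv R).
Proof.
have -> : @GRing.inv R = (fun x => x * powR (x ^+ 2) (-1)).
  apply/funext => x; rewrite powR_inv1 ?sqr_ge0 //.
  have [->|x0] := eqVneq x 0; first by rewrite invr0 mul0r.
  by rewrite expr2 invfM mulrA divff // mul1r.
apply: measurable_funM => //.
apply: (@measurableT_comp _ _ _ _ _ _ (fun y : R => powR y (-1)) _ (fun x : R => x ^+ 2)).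
  exact: measurable_powR.
exact: measurable_funX.
Qed.

Lemma measure_finite_union_le d (T : measurableType d) (m : {measure set T -> \bar R})
    (I : Type) (s : seq I) (F : I -> set T) (c : R) :
  (forall i, measurable (F i)) -> (forall i, (m (F i) <= c%:E)%E) ->
  (m (\big[setU/set0]_(i <- s) F i) <= ((size s)%:R * c)%:E)%E.
Proof.
move=> mF Fc; elim: s => [|i s IHs]; first by rewrite big_nil measure0 mul0r.
rewrite big_cons; apply: le_trans (measureU2 m (mF i) _) _.
  exact: bigsetU_measurable.
rewrite /= -natr1 mulrDl mul1r addrC EFinD; exact: leeD.
Qed.

(** The telescoping weights have partial sums below 1; they dominate inverse squares up to a factor
    2. *)
Lemma measure_telescoping_union_le d (T : measurableType d)
    (m : {measure set T -> \bar R}) (F : nat -> set T) (c : R) : 0 <= c ->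
  (forall n, measurable (F n)) ->
  (forall n, (m (F n) <= (c * (n.+1%:R^-1 - n.+2%:R^-1))%:E)%E) ->
  (m (\bigcup_n F n) <= c%:E)%E.
Proof.
move=> c0 mF Fc.
apply: (@le_trans _ _ (\sum_(0 <= n <oo) m (F n))%E).
  by apply: measure_sigma_subadditive => //; exact: bigcup_measurable.
apply: lime_le; first by apply: is_cvg_nneseries => n _ _; exact: measure_ge0.
apply: nearW => n.
apply: (@le_trans _ _ (\sum_(0 <= i < n) (c * (i.+1%:R^-1 - i.+2%:R^-1))%:E)%E).
  by apply: lee_sum => i _; exact: Fc.
rewrite sumEFin lee_fin -mulr_sumr ler_piMr //.
suff -> : \sum_(0 <= i < n) (i.+1%:R^-1 - i.+2%:R^-1) = 1 - n.+1%:R^-1 :> R.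
  by rewrite gerBl invr_ge0.
elim: n => [|n IHn]; first by rewrite big_geq // invr1 subrr.
by rewrite big_nat_recr //= IHn addrA subrK.
Qed.

Lemma product_lebesgue_slice_le (X : set (R * R)) (c h0 : R) :
  0 <= c -> 0 <= h0 -> measurable X -> X `<=` setT `*` `[0, h0] ->
  (forall h, (lebesgue_measure (ysection X h) <= c%:E)%E) ->
  ((@lebesgue_measure R \x @lebesgue_measure R) X <= (c * h0)%:E)%E.
Proof.
move=> c0 h00 mX Xh Xc.
(* The slices are controlled at fixed h, so the iterated integral that ends with h is used. *)
rewrite (@product_measure_unique _ _ _ _ _ _ _
  (@lebesgue_measure R \x^ @lebesgue_measure R)%E) //; last first.
  by move=> A B mA mB; exact: product_measure2E.
apply: (@le_trans _ _ (\int[@lebesgue_measure R]_h (c * \1_(`[0, h0]%classic : set R) h)%:E)%E).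
  apply: ge0_le_integral => //.
  - exact: measurable_fun_ysection.
  - by apply/measurable_EFinP; apply: measurable_funM => //; exact: measurable_indic.
  move=> h _ /=; rewrite indicE.
  have [hin|hout] := boolP (h \in (`[0, h0]%classic : set R)); first by rewrite mulr1.
  rewrite mulr0 (_ : ysection X h = set0) ?measure0 //.
  apply/seteqP; split => // r /ysectionP/Xh[_ /= hin].
  by move: hout; rewrite notin_setE.
under eq_integral do rewrite EFinM.
rewrite ge0_integralZl //; last first.
  by apply/measurable_EFinP; exact: measurable_indic.
pose I : set R := `[0, h0]%classic.
have mI : measurable I by exact: measurable_itv.
rewrite -/I; have -> : (\int[@lebesgue_measure R]_h (\1_I h)%:E = lebesgue_measure I)%E.
  by rewrite integral_indic // setIT.
rewrite /I lebesgue_measure_itv /= lte_fin.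
rewrite EFinM; apply: lee_pmul => //; case: ifP => // _.
  by rewrite -EFinD oppr0 addr0 ?lee_fin.
by rewrite -EFinD oppr0 addr0.
Qed.

Lemma piece_exists (T : nat) (delta x : R) : (0 < T)%N -> 0 <= x <= T%:R * delta ->
  exists2 i : 'I_T, i%:R * delta <= x & x <= i.+1%:R * delta.
Proof.
move=> T0 /andP[x0]; elim: T T0 => // -[|T] IHT _ xT.
  by exists ord0; rewrite ?mul0r.
have [xle|/ltW xge] := leP x (T.+1%:R * delta).
  by have [//|i i1 i2] := IHT _ xle; exists (widen_ord (leqnSn _) i).
by exists ord_max.
Qed.

End MeasureTools.

(** * Resonant sets at fixed step size *)

Section ResonantSets.
Variable R : realType.
Implicit Types (kap : nat -> int) (M n : nat) (lam : R).

Lemma measurable_sin : measurable_fun [set: R] (@sin R).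
Proof. apply: continuous_measurable_fun; exact: continuous_sin. Qed.

Lemma measurable_cos : measurable_fun [set: R] (@cos R).
Proof. apply: continuous_measurable_fun; exact: continuous_cos. Qed.

Lemma measurable_shift_coef n : measurable_fun [set: R] (@shift_coef R n).
Proof.
have my : measurable_fun [set: R] (fun h : R => n%:R * h) by exact: measurable_funM.
have ms : measurable_fun [set: R] (fun h : R => sin (n%:R * h)).
  exact: (measurableT_comp measurable_sin my).
have mc : measurable_fun [set: R] (fun h : R => cos (n%:R * h)).
  exact: (measurableT_comp measurable_cos my).
have mi : measurable_fun [set: R] (fun h : R => (sin (n%:R * h))^-1).
  apply: (@measurableT_comp _ _ _ _ _ _ (@GRing.inv R) _ (fun h : R => sin (n%:R * h))) => //.
  exact: measurable_invr.
rewrite /shift_coef /cot_defect; apply: measurable_funM => //.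
apply: measurable_funB => //; apply: measurable_funM => //.
exact: measurable_funM.
Qed.

Lemma measurable_mod_freq lam n :
  measurable_fun [set: R * R] (fun z => mod_freq n (lam * z.1 ^+ 2) z.2).
Proof.
have mmu : measurable_fun [set: R * R] (fun z => lam * z.1 ^+ 2).
  by apply: measurable_funM => //; apply: measurable_funX; exact: measurable_fst.
rewrite /mod_freq; apply: measurable_funD; last first.
  apply: measurable_funM; last exact: measurable_funX.
  by apply: (measurableT_comp (measurable_shift_coef n)); exact: measurable_snd.
apply: (@measurableT_comp _ _ _ _ _ _ (@Num.sqrt R) _
  (fun z : R * R => n%:R * (n%:R + 2 * (lam * z.1 ^+ 2)))).
  apply: continuous_measurable_fun; exact: sqrt_continuous.
apply: measurable_funM => //; apply: measurable_funD => //.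
exact: measurable_funM.
Qed.

(** A family of length at most r is written as r unit terms, each an index with a sign; 0, 1, 2
    encode the signs -1, 0, 1. The codes form a finite type whose size is polynomial in M. *)
Definition coef_of_terms M (t : seq ('I_M.+1 * 'I_3)) (n : nat) : int :=
  \sum_(p <- t) (p.1 == n :> nat)%:Z * ((p.2 : nat)%:Z - 1).

Lemma coef_of_terms_surjective M r kap : supported M kap -> (coef_len M kap <= r)%N ->
  exists t : r.-tuple ('I_M.+1 * 'I_3), coef_of_terms t =1 kap.
Proof.
elim: r kap => [|r IHr] kap sk.
  rewrite leqn0 => /eqP/(coef_len0 sk) k0.
  by exists [tuple]; move=> n; rewrite /coef_of_terms big_nil k0.
have [k0|kpos] := posnP (coef_len M kap) => klen.
  have [|t tE] := IHr kap sk; first by rewrite k0.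
  (* The code 1 means coefficient 0, so this entry is padding. *)
  exists [tuple of (ord0, inord 1) :: t] => n.
  by rewrite /coef_of_terms big_cons inordK // subrr mulr0 add0r -tE.
have [n [s [kap' pk]]] := peelingP sk kpos.
have [|t tE] := IHr kap' (supported_le (peel_le pk) (peel_supp' pk)).
  by move: klen; rewrite (peel_len pk).
exists [tuple of (inord n, inord (if s == 1 then 2 else 0)) :: t] => i.
rewrite /coef_of_terms big_cons /= -/(coef_of_terms t i) tE (peel_coef pk) addrC inordK ?ltnS ?(peel_le pk) //.
rewrite eq_sym mulrC; congr (_ + _ * _).
by case: (peel_sgn pk) => ->; rewrite inordK.
Qed.

Lemma coef_dot_widen M L kap (w : nat -> R) : (M <= L)%N -> supported M kap ->
  coef_dot L kap w = coef_dot M kap w.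
Proof.
move=> ML sk; rewrite /coef_dot.
rewrite [RHS](big_ord_widen L.+1 (fun n => (kap n)%:~R * w n)) // [RHS]big_mkcond /=.
apply: eq_bigr => i _; case: ifP => // /negbT; rewrite -leqNgt => Mi.
have [->|/sk/andP[_ iM]] := eqVneq (kap i) 0; first by rewrite mul0r.
by have := leq_ltn_trans iM Mi; rewrite ltnn.
Qed.

Lemma coef_len_widen M L kap : (M <= L)%N -> supported M kap ->
  coef_len L kap = coef_len M kap.
Proof.
move=> ML sk; rewrite /coef_len.
rewrite [RHS](big_ord_widen L.+1 (fun n => `|kap n|%N)) // [RHS]big_mkcond /=.
apply: eq_bigr => i _; case: ifP => // /negbT; rewrite -leqNgt => Mi.
have [->|/sk/andP[_ iM]] := eqVneq (kap i) 0; first by [].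
by have := leq_ltn_trans iM Mi; rewrite ltnn.
Qed.

Lemma coef_dot_mod_freq lam M kap (m rho h : R) : `|lam| = 1 ->
  m + coef_dot M kap (fun n => mod_freq n (lam * rho ^+ 2) h) =
  phase_deriv lam M kap m (coef_dot M kap (@shift_coef R ^~ h)) 0 (rho ^+ 2).
Proof.
move=> lam1; have lam2 : lam ^+ 2 = 1 by rewrite -(real_normK (num_real lam)) lam1 expr1n.
rewrite /phase_deriv /coef_dot /= expr0 !mul1r addrCA; congr (_ + _).
rewrite mulr_suml -big_split /=; apply: eq_bigr => n _.
by rewrite /mod_freq /sqrt_term expr0 invr1 mulr1 exprMn lam2 mul1r mulrDr !mulrA.
Qed.

(** A larger set would contain 2^(N+3) points separated by g. As rho >= rho1, their squares are
    separated by 2 rho1 g, which the numerical hypothesis makes incompatible with the moment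
    bound. *)
Lemma level_slice_measure N lam M kap (m A k rho0 rho1 g eps : R) (T i : nat) (E : set R) :
  `|lam| = 1 -> 0 < k <= 1 -> 0 < rho1 -> 0 < rho0 ->
  (forall sig, 0 <= sig <= rho0 ^+ 2 -> k <= 1 + 2 * (lam * sig)) ->
  supported M kap -> (0 < coef_len M kap <= N.+1)%N ->
  (i < T)%N -> 0 < g -> rho1 * g <= 1 ->
  eps * (rho1 * g) ^- (N + 3) + lipschitz_const N k * (2 * rho0 ^+ 2 / T%:R)
    < moment_const N k (rho0 ^+ 2) / M%:R ^+ (2 * N + 2) ->
  measurable E ->
  (forall rho, E rho -> [/\ rho1 <= rho <= rho0,
     i%:R * (rho0 / T%:R) <= rho <= i.+1%:R * (rho0 / T%:R) &
     `|phase_deriv lam M kap m A 0 (rho ^+ 2)| <= eps]) ->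
  (lebesgue_measure E <= ((2 ^ (N + 3))%:R * (2 * g))%:E)%E.
Proof.
move=> lam1 kbnd rho10 rho00 disp sk klen iT g0 g1 lt mE EP.
have T0 : 0 < T%:R :> R by rewrite ltr0n (leq_ltn_trans _ iT).
have Eab : E `<=` `[0, rho0].
  move=> rho /EP[/andP[h1 h2] _ _]; rewrite /= in_itv /= h2 andbT.
  by apply: le_trans h1; exact: ltW.
have pos2 : (0 < 2 ^ (N + 3))%N by rewrite expn_gt0.
have [[x [xE xg]]|mes] := separated_points (2 ^ (N + 3)).-1 g0 mE Eab; last first.
  apply: le_trans mes _; rewrite lee_fin ler_wpM2r ?mulr_ge0 ?(ltW g0) //.
  by rewrite ler_nat leq_pred.
rewrite prednK // in xE.
exfalso; move: lt; apply/negP; rewrite -leNgt.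
pose a := (i%:R * (rho0 / T%:R)) ^+ 2; pose b := (i.+1%:R * (rho0 / T%:R)) ^+ 2.
have d0 : 0 <= rho0 / T%:R by rewrite divr_ge0 // ltW.
have brho : b <= rho0 ^+ 2.
  rewrite lerXn2r ?nnegrE ?mulr_ge0 ?(ltW rho00) //.
  by rewrite mulrA ler_pdivrMr // mulrC ler_pM2l // ler_nat.
have sab sig : a <= sig <= b -> 0 <= sig <= rho0 ^+ 2.
  move=> /andP[h1 h2]; rewrite (le_trans _ h1) ?sqr_ge0 //=; exact: le_trans brho.
(* The difference of squares has the factor 2i + 1 <= 2T, so a piece has length O(1/T) in sig as
   well. *)
have ab : b - a <= 2 * rho0 ^+ 2 / T%:R.
  have -> : b - a = (i.+1%:R ^+ 2 - i%:R ^+ 2) * (rho0 / T%:R) ^+ 2 by rewrite /a /b; ring.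
  have -> : 2 * rho0 ^+ 2 / T%:R = 2 * T%:R * (rho0 / T%:R) ^+ 2 by field; rewrite gt_eqF.
  rewrite ler_wpM2r ?sqr_ge0 // -natr1.
  have : i.+1%:R <= T%:R :> R by rewrite ler_nat.
  by rewrite -natr1; clear; rewrite !expr2; lra.
have gp : 0 < 2 * (rho1 * g) by rewrite !mulr_gt0.
have H : moment_const N k (rho0 ^+ 2) / M%:R ^+ (2 * N + 2) <=
    eps * (2 / (2 * (rho1 * g))) ^+ (N + 3) + lipschitz_const N k * (b - a).
  apply: (@phase_level_separation R N lam M kap m A k (rho0 ^+ 2) a b
            (2 * (rho1 * g)) eps (fun i => x i ^+ 2)) => //.
  - by rewrite sqr_ge0.
  - move=> sig n /sab/disp h1 n0; rewrite -mulrA; apply: dispersion_ge => //.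
    by case/andP: kbnd.
  - by move=> sig /sab/andP[h1 h2]; rewrite ger0_norm.
  - by rewrite gp /=; clear - g1; lra.
  - move=> j /xE/EP[/andP[h0 _] /andP[h1 h2] _].
    have xj0 : 0 <= x j by apply: le_trans h0; exact: ltW.
    have ia0 : 0 <= i%:R * (rho0 / T%:R) by rewrite mulr_ge0.
    have ib0 : 0 <= i.+1%:R * (rho0 / T%:R) by rewrite mulr_ge0.
    by apply/andP; split; rewrite lerXn2r ?nnegrE.
  - move=> j jN; have [/andP[h0 _] _ _] := EP _ (xE _ (ltnW jN)).
    have h1 : x j + g <= x j.+1 by apply: xg; rewrite -ltnS prednK.
    have : (x j + g) ^+ 2 <= x j.+1 ^+ 2.
      rewrite lerXn2r ?nnegrE //; first by clear - h0 rho10 g0; lra.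
      by clear - h0 rho10 g0 h1; lra.
    have : 2 * g * rho1 <= 2 * g * x j by rewrite ler_wpM2l // mulr_ge0 // ltW.
    have := sqr_ge0 g; rewrite !expr2; clear; lra.
  - by move=> j /xE/EP[].
apply: le_trans H _.
rewrite (_ : 2 / (2 * (rho1 * g)) = (rho1 * g)^-1); last first.
  by field; rewrite !gt_eqF.
rewrite exprVn lerD2l ler_wpM2l // lipschitz_const_ge0 //; by case/andP: kbnd.
Qed.

End ResonantSets.

(** * Choice of parameters and measure of the exceptional set *)

Section NonresonantSet.
Variable R : realType.
Implicit Types (kap : nat -> int) (M n : nat) (lam : R).

(** 2N + 2 is the Vandermonde loss. The separation g is of order M^-(N + 4 + (2N + 2)) and enters
    with power N + 3; its exponent pays for N + 2 powers of M counting kappa and m, 2N + 2 counting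
    pieces, and 2 for summability. *)
Definition res_exp (N : nat) : nat := (2 * N + 2 + (N + 3) * (N + 4 + (2 * N + 2)))%N.

Definition resonant_set lam (rho0 rho1 h0 : R) M kap (m : int) (T i : nat) (eps : R) :
    set (R * R) :=
  (`[rho1, rho0]%classic `&` `[i%:R * (rho0 / T%:R), i.+1%:R * (rho0 / T%:R)]%classic)
    `*` `[0, h0]%classic
  `&` [set z | `|m%:~R + coef_dot M kap (fun n => mod_freq n (lam * z.1 ^+ 2) z.2)| < eps].

Lemma measurable_resonant_set lam (rho0 rho1 h0 : R) M kap m T i eps :
  measurable (resonant_set lam rho0 rho1 h0 M kap m T i eps).
Proof.
apply: measurableI; first by apply: measurableX; [apply: measurableI|]; exact: measurable_itv.
pose f (z : R * R) := m%:~R + coef_dot M kap (fun n => mod_freq n (lam * z.1 ^+ 2) z.2).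
have mf : measurable_fun [set: R * R] f.
  apply: measurable_funD => //; rewrite /coef_dot.
  apply: measurable_sum => n; apply: measurable_funM => //.
  exact: measurable_mod_freq.
have -> : [set z | `|m%:~R + coef_dot M kap (fun n => mod_freq n (lam * z.1 ^+ 2) z.2)|
    < eps] = setT `&` f @^-1` `](- eps), eps[%classic.
  by rewrite setTI; apply/seteqP; split => z /=; rewrite in_itv /= -ltr_norml.
by apply: mf => //; exact: measurable_itv.
Qed.

Lemma resonant_set_measure N lam M kap (m : int) (k rho0 rho1 h0 g eps : R) (T i : nat) :
  `|lam| = 1 -> 0 < k <= 1 -> 0 < rho1 -> 0 < rho0 -> 0 < h0 ->
  (forall sig, 0 <= sig <= rho0 ^+ 2 -> k <= 1 + 2 * (lam * sig)) ->
  supported M kap -> (0 < coef_len M kap <= N.+1)%N ->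
  (i < T)%N -> 0 < g -> rho1 * g <= 1 ->
  eps * (rho1 * g) ^- (N + 3) + lipschitz_const N k * (2 * rho0 ^+ 2 / T%:R)
    < moment_const N k (rho0 ^+ 2) / M%:R ^+ (2 * N + 2) ->
  ((@lebesgue_measure R \x @lebesgue_measure R)
     (resonant_set lam rho0 rho1 h0 M kap m T i eps)
   <= ((2 ^ (N + 3))%:R * (2 * g) * h0)%:E)%E.
Proof.
move=> lam1 kbnd rho10 rho00 h00 disp sk klen iT g0 g1 lt.
have mX := measurable_resonant_set lam rho0 rho1 h0 M kap m T i eps.
apply: product_lebesgue_slice_le => //.
- by rewrite !mulr_ge0 // ltW.
- exact: ltW.
- by move=> z [[_ ?] _].
move=> h; apply: (@level_slice_measure R N lam M kap m%:~R
   (coef_dot M kap (@shift_coef R ^~ h)) k rho0 rho1 g eps T i) => //.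
  exact: measurable_ysection.
move=> rho /ysectionP[[[/= h1 h2] _] h3]; split.
- by move: h1; rewrite in_itv.
- by move: h2; rewrite in_itv.
- by rewrite -coef_dot_mod_freq // ltW.
Qed.

(** The factors count coded families, integers [m] and pieces; M + 1 <= 2M turns 3 into 6. *)
Lemma index_count N Cp T0 M : (0 < M)%N ->
  ((3 * M.+1) ^ N.+1 * (2 * (Cp * M) + 1) * (T0 * M ^ (2 * N + 2)) <=
   6 ^ N.+1 * (2 * Cp + 1) * T0 * M ^ (N + 2 + (2 * N + 2)))%N.
Proof.
move=> M0; have -> : (M ^ (N + 2 + (2 * N + 2)) = M ^ N.+1 * M * M ^ (2 * N + 2))%N.
  by rewrite expnD addnS expnSr addn1.
have h1 : ((3 * M.+1) ^ N.+1 <= 6 ^ N.+1 * M ^ N.+1)%N.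
  by rewrite -expnMn leq_exp2r //; lia.
have h2 : (2 * (Cp * M) + 1 <= (2 * Cp + 1) * M)%N by lia.
have := leq_mul (leq_mul h1 h2) (leqnn (T0 * M ^ (2 * N + 2))).
by move/leq_trans; apply; rewrite leq_eqVlt; apply/orP; left; apply/eqP; lia.
Qed.

Lemma nonresonant_set lam (rho0 k h0 gamma : R) (N Cp : nat) :
  `|lam| = 1 -> 0 < rho0 -> 0 < k <= 1 ->
  (forall sig, 0 <= sig <= rho0 ^+ 2 -> k <= 1 + 2 * (lam * sig)) ->
  0 < h0 -> 0 < gamma ->
  exists2 e : R, 0 < e <= 1 & exists P : set (R * R),
    [/\ measurable P, P `<=` `[0, rho0] `*` `[0, h0],
        ((rho0 * h0 - gamma)%:E <= (@lebesgue_measure R \x @lebesgue_measure R) P)%E &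
        forall rho h, P (rho, h) -> forall L,
          nonresonant N Cp (res_exp N) L e (fun n => mod_freq n (lam * rho ^+ 2) h)].
Proof.
move=> lam1 rho00 kbnd disp h00 gam0; have /andP[k0 k1] := kbnd.
have D0 := moment_const_gt0 N k0 (sqr_ge0 rho0).
set D := moment_const N k (rho0 ^+ 2) in D0.
have L0 := lipschitz_const_ge0 N k0; set Lip := lipschitz_const N k in L0.
pose b := (2 * N + 2)%N.
(* The discarded strip rho < rho1 has measure at most gamma/2. *)
pose rho1 := Num.min rho0 (gamma / (2 * h0)).
have rho10 : 0 < rho1 by rewrite lt_min rho00 divr_gt0 // mulr_gt0.
have rho1h : rho1 * h0 <= gamma / 2.
  rewrite -ler_pdivlMr //; rewrite (_ : gamma / 2 / h0 = gamma / (2 * h0)).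
    by rewrite ge_min lexx orbT.
  by field; rewrite gt_eqF.
have rho1le : rho1 <= rho0 by rewrite ge_min lexx.
(* Makes the variation over one piece at most half the moment bound at every level. *)
pose T0 := (Num.bound (4 * Lip * rho0 ^+ 2 / D)).+1.
have T0P : 4 * Lip * rho0 ^+ 2 <= D * T0%:R.
  rewrite (mulrC D) -ler_pdivrMr // /T0.
  have q0 : 0 <= 4 * Lip * rho0 ^+ 2 / D.
    by apply: divr_ge0; [apply: mulr_ge0; [rewrite mulr_ge0 | exact: sqr_ge0] | exact: ltW].
  by apply: le_trans (ltW (archi_boundP q0)) _; rewrite ler_nat.
pose K := (6 ^ N.+1 * (2 * Cp + 1) * T0)%N.
have K0 : 0 < K%:R :> R by rewrite ltr0n !muln_gt0 expn_gt0 addn1.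
have Kidx M : (0 < M)%N -> ((3 * M.+1) ^ N.+1 * (2 * (Cp * M) + 1) * (T0 * M ^ b) <=
    K * M ^ (N + 2 + b))%N by exact: index_count.
clearbody K.
have p20 : 0 < (2 ^ (N + 3))%:R :> R by rewrite ltr0n expn_gt0.
(* The first entry gives rho1 g <= 1; the second makes the total measure at level M at most gamma/(4
   M^2). *)
pose g0 := Num.min rho1^-1 (gamma / (8 * K%:R * (2 ^ (N + 3))%:R * h0)).
have g00 : 0 < g0 by rewrite lt_min invr_gt0 rho10 divr_gt0 // !mulr_gt0.
have rho1g : rho1 * g0 <= 1.
  by rewrite mulrC -ler_pdivlMr // mul1r ge_min lexx.
have Kg : K%:R * (2 ^ (N + 3))%:R * 2 * g0 * h0 <= gamma / 4.
  have : g0 <= gamma / (8 * K%:R * (2 ^ (N + 3))%:R * h0) by rewrite ge_min lexx orbT.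
  rewrite ler_pdivlMr ?mulr_gt0 //; clear; lra.
(* Chosen so that the term with the small values is at most a quarter of the moment bound; with the
   half used by the variation, the inequality is strict. *)
pose e0 := D / 4 * (rho1 * g0) ^+ (N + 3).
have e00 : 0 < e0.
  by apply: mulr_gt0; [rewrite divr_gt0 | rewrite exprn_gt0 // mulr_gt0].
pose e := Num.min 1 e0.
have ebnd : 0 < e <= 1 by rewrite lt_min ltr01 e00 ge_min lexx.
exists e => //.
pose eps M := e / M%:R ^+ res_exp N.
pose T M := (T0 * M ^ b)%N.
pose I M : finType := (N.+1.-tuple ('I_M.+1 * 'I_3) * 'I_(2 * (Cp * M) + 1) * 'I_(T M))%type.
pose good M (t : N.+1.-tuple ('I_M.+1 * 'I_3)) :=
  `[< supported M (coef_of_terms t) /\ (0 < coef_len M (coef_of_terms t) <= N.+1)%N >].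
pose F M (x : I M) := if good M x.1.1
  then resonant_set lam rho0 rho1 h0 M (coef_of_terms x.1.1)
         ((x.1.2 : nat)%:Z - (Cp * M)%:Z) (T M) x.2 (eps M)
  else set0.
have mF M x : measurable (F M x).
  by rewrite /F; case: ifP => // _; exact: measurable_resonant_set.
pose bad n := \big[setU/set0]_(x <- enum (I n.+1)) F n.+1 x.
have mbad n : measurable (bad n) by apply: bigsetU_measurable.
pose mu := (@lebesgue_measure R \x @lebesgue_measure R)%E.
have muF M x : (0 < M)%N ->
    (mu (F M x) <= ((2 ^ (N + 3))%:R * (2 * (g0 / M%:R ^+ (N + 4 + b))) * h0)%:E)%E.
  move=> M0; have M0R : 0 < M%:R :> R by rewrite ltr0n.
  have M1 : 1 <= M%:R :> R by rewrite ler1n.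
  have gM0 : 0 < g0 / M%:R ^+ (N + 4 + b) by rewrite divr_gt0 // exprn_gt0.
  rewrite /F; case: ifP => [/asboolP[sk klen]|_]; last first.
    by rewrite /mu measure0 lee_fin !mulr_ge0 // ltW.
  apply: (@resonant_set_measure N lam M _ _ k) => //.
    rewrite mulrA ler_pdivrMr ?exprn_gt0 // mul1r; apply: le_trans rho1g _.
    by rewrite exprn_ege1.
  have T0M : 0 < T0%:R :> R by [].
  have TE : (T M)%:R = T0%:R * M%:R ^+ b :> R by rewrite /T natrM natrX.
  have h1 : Lip * (2 * rho0 ^+ 2 / (T M)%:R) <= D / 2 / M%:R ^+ b.
    rewrite TE -(ler_pM2r (mulr_gt0 T0M (exprn_gt0 b M0R))).
    have -> : Lip * (2 * rho0 ^+ 2 / (T0%:R * M%:R ^+ b)) * (T0%:R * M%:R ^+ b)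
      = Lip * (2 * rho0 ^+ 2) by field; rewrite expf_neq0 ?gt_eqF.
    have -> : D / 2 / M%:R ^+ b * (T0%:R * M%:R ^+ b) = D * T0%:R / 2.
      by field; rewrite expf_neq0 ?gt_eqF.
    by clear - T0P; lra.
  have h2 : eps M * (rho1 * (g0 / M%:R ^+ (N + 4 + b))) ^- (N + 3) <= D / 4 / M%:R ^+ b.
    rewrite ler_pdivrMr; last exact/exprn_gt0/(mulr_gt0 rho10 gM0).
    have -> : D / 4 / M%:R ^+ b * (rho1 * (g0 / M%:R ^+ (N + 4 + b))) ^+ (N + 3) =
        e0 / M%:R ^+ res_exp N.
      rewrite (mulrA rho1) expr_div_n -exprM /e0 /res_exp -/b [((N + 3) * _)%N]mulnC.
      rewrite (exprD _ b); move: (exprn_gt0 b M0R) (exprn_gt0 ((N + 4 + b) * (N + 3)) M0R).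
      set u := _ ^+ b; set v := _ ^+ (_ * _); set w := (rho1 * g0) ^+ _ => u0 v0.
      by field; rewrite !gt_eqF.
    by rewrite ler_pM2r ?invr_gt0 ?exprn_gt0 // ge_min lexx orbT.
  have : 0 < D / M%:R ^+ b by rewrite divr_gt0 // exprn_gt0.
  move=> h3; apply: le_lt_trans (lerD h2 h1) _; rewrite -/b -/D.
  by clear - h3; lra.
have mubad n : (mu (bad n) <= ((gamma / 2) * (n.+1%:R^-1 - n.+2%:R^-1))%:E)%E.
  have M0R : 0 < n.+1%:R :> R by rewrite ltr0n.
  have H := @measure_finite_union_le R _ _ (@lebesgue_measure R \x @lebesgue_measure R)%E
    _ (enum (I n.+1)) (F n.+1) _ (mF n.+1) (fun x => muF n.+1 x isT).
  apply: le_trans H _.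
  rewrite lee_fin -cardE !card_prod card_tuple card_prod !card_ord.
  set c := _ * h0.
  have c0 : 0 <= c by rewrite !mulr_ge0 ?divr_ge0 ?exprn_ge0 // ltW.
  apply: le_trans (_ : (K * n.+1 ^ (N + 2 + b))%:R * c <= _).
    by rewrite ler_wpM2r // ler_nat [(n.+2 * 3)%N]mulnC; apply: Kidx.
  apply: le_trans (_ : gamma / 4 / n.+1%:R ^+ 2 <= _).
    have -> : (K * n.+1 ^ (N + 2 + b))%:R * c =
        (K%:R * (2 ^ (N + 3))%:R * 2 * g0 * h0) / n.+1%:R ^+ 2.
      have e1 : (N + 4 + b = N + 2 + b + 2)%N by clear; lia.
      have e2 : (K * n.+1 ^ (N + 2 + b))%:R = K%:R * n.+1%:R ^+ (N + 2 + b) :> R.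
        by rewrite natrM natrX.
      have e3 := exprn_gt0 (N + 2 + b) M0R; rewrite /c e2 e1 (exprD _ (N + 2 + b)); move: e3 M0R p20.
      set u := _ ^+ (N + 2 + b); set v := n.+1%:R; set p := (2 ^ (N + 3))%:R; clear => u0 v0 p0.
      by field; rewrite !gt_eqF.
    by rewrite ler_pM2r // invr_gt0 exprn_gt0.
  rewrite -(natr1 n.+1); have v1 : 1 <= n.+1%:R :> R by rewrite ler1n.
  move: v1; set v := n.+1%:R; clear - gam0 => v1.
  have v0 : 0 < v by clear - v1; lra.
  (* Here 1/v^2 is at most twice 1/v - 1/(v+1), which turns gamma/4 into gamma/2. *)
  have -> : gamma / 2 * (v^-1 - (v + 1)^-1) = gamma / 4 / v ^+ 2 * (2 * v / (v + 1)).
    by field; apply/andP; split; rewrite gt_eqF //; clear - v0; lra.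
  rewrite ler_peMr ?divr_ge0 ?exprn_ge0 ?(ltW gam0) ?(ltW v0) //.
  by rewrite ler_pdivlMr; clear - v1; lra.
pose Bad := \bigcup_n bad n.
have mBad : measurable Bad by apply: bigcup_measurable.
have muBad : (mu Bad <= (gamma / 2)%:E)%E.
  by apply: measure_telescoping_union_le => //; rewrite divr_ge0 // ltW.
pose Q : set (R * R) := `[rho1, rho0]%classic `*` `[0, h0]%classic.
have mQ : measurable Q by apply: measurableX; exact: measurable_itv.
exists (Q `\` Bad); split.
- exact: measurableD.
- move=> [rho h] [[/= h1 h2] _]; split => //=.
  by move: h1; rewrite !in_itv /= => /andP[h1 ->]; rewrite (le_trans _ h1) // ltW.
- have muQ : mu Q = ((rho0 - rho1) * h0)%:E.
    have -> : mu Q = (lebesgue_measure (`[rho1, rho0]%classic : set R) *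
        lebesgue_measure (`[0%R, h0]%classic : set R))%E.
      by apply: product_measure1E; exact: measurable_itv.
    have -> : lebesgue_measure (`[rho1, rho0]%classic : set R) = (rho0 - rho1)%:E.
      rewrite lebesgue_measure_itv /= lte_fin; case: ltP => // h1.
      by rewrite (@le_anti _ _ rho0 rho1) ?subrr // h1 rho1le.
    have -> : lebesgue_measure (`[0, h0]%classic : set R) = h0%:E.
      by rewrite lebesgue_measure_itv /= lte_fin h00 -EFinD oppr0 addr0.
    by rewrite EFinM.
  have : (mu Q <= mu (Q `\` Bad) + mu Bad)%E.
    apply: le_trans (measureU2 _ _ _) => //; last exact: measurableD.
    by apply: le_measure; rewrite ?inE //; [apply: measurableU => //; exact: measurableD|
      by move=> z Qz; have [|] := pselect (Bad z); [right|left]].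
  move=> h1; have {}h1 := le_trans h1 (leeD (lexx _) muBad).
  rewrite -(@leeD2rE _ (gamma / 2)%:E) //; apply: le_trans h1.
  by rewrite muQ -EFinD lee_fin; clear - rho1h; lra.
move=> rho h [[/= rhoin hin] nbad] L M kap m /andP[M0 ML] sk klen mM.
rewrite leNgt; apply/negP => lt.
rewrite (coef_len_widen ML sk) in klen; rewrite (coef_dot_widen _ ML sk) in lt.
have [_ klenN] := andP klen.
have [t tE] := coef_of_terms_surjective sk klenN.
have {}tE : coef_of_terms t = kap by apply/funext.
(* Levels start at 1, so [bad n] holds level n + 1; the integer [m] is stored shifted by Cp M. *)
apply: nbad; exists M.-1 => //; rewrite /bad prednK // -bigcup_seq.
have mlt : (`|(m + (Cp * M)%:Z)%R| < 2 * (Cp * M) + 1)%N by clear - mM; lia.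
have [i i1 i2] : exists2 i : 'I_(T M), i%:R * (rho0 / (T M)%:R) <= rho &
    rho <= i.+1%:R * (rho0 / (T M)%:R).
  have TM0 : (0 < T M)%N by rewrite muln_gt0 expn_gt0 M0.
  apply: piece_exists => //; rewrite mulrCA divff ?pnatr_eq0 -?lt0n // mulr1.
  by move: rhoin; rewrite in_itv /= => /andP[h1 ->]; rewrite (le_trans _ h1) // ltW.
exists (t, Ordinal mlt, i); first by rewrite /= mem_enum.
rewrite /F /= ifT; last by apply/asboolP; rewrite tE.
rewrite tE; split => /=.
  by do 2!split => //; rewrite /= in_itv /= i1.
rewrite (_ : `|(m + (Cp * M)%:Z)%R|%:Z - (Cp * M)%:Z = m) //.
by clear - mM; lia.
Qed.

End NonresonantSet.

(** * Summing the coefficients over modes of equal norm *)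

Section Aggregation.
Variables (R : realType) (J : finType) (p : J -> nat) (k : J -> int) (L : nat).
Hypothesis pL : forall j, (0 < p j <= L)%N.

Definition aggregate (n : nat) : int := \sum_(j | p j == n) k j.

Let q j : 'I_L.+1 := inord (p j).

Let qE j : q j = p j :> nat.
Proof. by rewrite inordK // ltnS; have /andP[] := pL j. Qed.

Lemma aggregate_supported : supported L aggregate.
Proof.
move=> n; rewrite /aggregate; have [j /eqP <- _|nj] := pickP (fun j => p j == n); first exact: pL.
by rewrite big_pred0 ?eqxx.
Qed.

Lemma aggregate_dot (w : nat -> R) :
  coef_dot L aggregate w = \sum_j (k j)%:~R * w (p j).
Proof.
rewrite (partition_big q xpredT) //=; apply: eq_bigr => n _.
rewrite /aggregate rmorph_sum /= mulr_suml; apply: eq_big => j.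
  by rewrite /= -val_eqE /= qE.
by move=> /eqP ->.
Qed.

Lemma aggregate_len_le : (coef_len L aggregate <= \sum_j `|k j|)%N.
Proof.
rewrite (partition_big q xpredT) //=; apply: leq_sum => n _.
rewrite /aggregate [X in (_ <= X)%N](eq_bigl (fun j => p j == n)); last first.
  by move=> j; rewrite -val_eqE /= qE.
rewrite -lez_nat abszE; apply: le_trans (ler_norm_sum _ _ _) _.
by rewrite (big_morph Posz PoszD (erefl 0%:Z)); apply: ler_sum => j _; rewrite abszE.
Qed.

Hypothesis simple : forall j, k j != 0 -> forall l, l != j -> p l = p j -> k l = 0.

(** At most one coefficient per sphere is nonzero, so nothing cancels. In general cancellation is
    possible and only [aggregate_len_le] holds, which is enough for exact resonances. *)
Lemma aggregate_abs (n : nat) : (`|aggregate n| = \sum_(j | p j == n) `|k j|)%N.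
Proof.
rewrite /aggregate.
have [j /andP[/eqP jn kj]|nj] := pickP (fun j => (p j == n) && (k j != 0)).
  have z l : (p l == n) && (l != j) -> k l = 0.
    by move=> /andP[/eqP ln lj]; apply: (simple kj) => //; rewrite ln.
  rewrite (bigD1 j) ?jn //= [in RHS](bigD1 j) ?jn //= big1 // [in RHS]big1.
    by rewrite addr0 addn0.
  by move=> l /z ->.
rewrite !big1 // => j jn; have := nj j; rewrite jn /= => /negbFE/eqP -> //.
Qed.

Lemma aggregate_len : coef_len L aggregate = (\sum_j `|k j|)%N.
Proof.
rewrite (partition_big q xpredT) //=; apply: eq_bigr => n _.
by rewrite aggregate_abs; apply: eq_bigl => j; rewrite -val_eqE /= qE.
Qed.

Lemma aggregate_prod : coef_prod L aggregate = (\prod_j p j ^ `|k j|)%N.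
Proof.
rewrite (partition_big q xpredT) //=; apply: eq_bigr => n _.
rewrite aggregate_abs expn_sum; apply: eq_big => j; first by rewrite -val_eqE /= qE.
by move=> /eqP ->.
Qed.

Lemma aggregate_neq0 j : k j != 0 -> aggregate (p j) != 0.
Proof.
move=> kj; rewrite -absz_gt0 aggregate_abs (bigD1 j) //= ltn_addr //.
by rewrite absz_gt0.
Qed.

End Aggregation.

(** * Phases on the unit circle and squared norms of modes *)

Section Phases.
Variable R : realType.

(** The modulus of e^(it) - 1 is 2 |sin(t/2)|, and t/2 stays in the range where sine is at least a
    third of its argument. *)
Lemma normc_expi_sub1 (t h : R) : 0 < h -> `|t| <= pi ->
  `|t| / (3 * h) <= Normc.normc ((expi t - 1) / h%:C%C).
Proof.
move=> h0 tpi.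
have -> : (expi t - 1) / h%:C%C = ((cos t - 1) / h +i* (sin t / h))%C.
  rewrite -fmorphV /= /expi; apply/eqP; rewrite eq_complex /=.
  by rewrite !mulr0 !subr0 add0r !eqxx.
rewrite /Normc.normc -[leLHS]ger0_norm ?divr_ge0 ?mulr_ge0 ?(ltW h0) //.
rewrite -sqrtr_sqr ler_sqrt; last by rewrite addr_ge0 ?sqr_ge0.
have s := @norm_sin_ge_third R (t / 2).
have {}s : `|t / 2| / 3 <= `|sin (t / 2)|.
  apply: s; rewrite normrM (ger0_norm (x := 2^-1)) //; clear - tpi; lra.
have ct : cos t = 1 - 2 * sin (t / 2) ^+ 2.
  rewrite -[in LHS](_ : (t / 2) *+ 2 = t); last by field.
  by rewrite cos_mulr2n cos2sin2; ring.
have -> : ((cos t - 1) / h) ^+ 2 + (sin t / h) ^+ 2 = (2 * `|sin (t / 2)|) ^+ 2 / h ^+ 2.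
  have -> : ((cos t - 1) / h) ^+ 2 + (sin t / h) ^+ 2 =
      ((cos t ^+ 2 + sin t ^+ 2) + 1 - 2 * cos t) / h ^+ 2.
    by field; rewrite gt_eqF.
  rewrite cos2Dsin2 ct exprMn real_normK ?num_real //.
  by congr (_ / _); ring.
have -> : (`|t| / (3 * h)) ^+ 2 = (2 * (`|t / 2| / 3)) ^+ 2 / h ^+ 2.
  by rewrite normrM (ger0_norm (x := 2^-1)) //; field; rewrite gt_eqF.
rewrite ler_pM2r ?invr_gt0 ?exprn_gt0 // lerXn2r ?nnegrE ?mulr_ge0 ?invr_ge0 //.
by rewrite ler_pM2l.
Qed.

Definition sqn (d : nat) (v : 'rV[int]_d) : nat := (\sum_i `|v 0%R i| ^ 2)%N.

Lemma enorm_sqr (d : nat) (v : 'rV[int]_d) : enorm R v ^+ 2 = (sqn v)%:R.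
Proof.
rewrite sqr_sqrtr; last by apply: sumr_ge0 => i _; rewrite sqr_ge0.
rewrite /sqn natr_sum; apply: eq_bigr => i _.
by rewrite natrX natr_absz intr_norm real_normK // num_real.
Qed.

Lemma sqn_mode_bounds (d K : nat) (j : mode d K) : (0 < sqn (mode_pt j) <= d * K ^ 2)%N.
Proof.
apply/andP; split.
  rewrite lt0n; apply: contraNneq (valP j) => /eqP.
  rewrite sum_nat_eq0 => /forallP h; apply/eqP/rowP => i.
  have /implyP/(_ isT) := h i; rewrite expn_eq0 andbT absz_eq0 => /eqP hi.
  by rewrite [RHS]mxE.
rewrite -[d in (d * _)%N]card_ord -sum_nat_const; apply: leq_sum => i _.
rewrite leq_exp2r // mxE; have := ltn_ord (val j i); clear; lia.
Qed.

End Phases.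

(** * From families indexed by squared norm back to modes *)

Lemma mode_dot_phase_le (R : realType) (d K N : nat) (w : nat -> R) (k : mode d K -> int)
    (h A : R) : (klen k <= N.+1)%N -> 0 <= A ->
  (forall n, (0 < n <= d * K ^ 2)%N -> 0 <= h * w n <= A) ->
  `|kdot k (fun j => w (sqn (mode_pt j))) * h| <= N.+1%:R * A.
Proof.
move=> klenN A0 wA; rewrite /kdot mulr_suml.
apply: le_trans (ler_norm_sum _ _ _) _.
apply: (@le_trans _ _ (\sum_(j : mode d K) `|k j|%N%:R * A)).
  apply: ler_sum => j _; have /andP[w0 w1] := wA _ (sqn_mode_bounds j).
  rewrite -mulrA normrM natr_absz intr_norm ler_wpM2l //.
  by rewrite mulrC ger0_norm.
by rewrite -mulr_suml -natr_sum ler_wpM2r // ler_nat.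
Qed.

(** A multiple of 2 pi of size at most pi is 0, so the combination vanishes, and nonresonance with m
    = 0 leaves only the zero aggregate. *)
Lemma exact_resonance_of_nonresonant (R : realType) (d K N Cp a : nat) (h e : R)
    (w : nat -> R) :
  0 < e -> 0 < h -> nonresonant N Cp a (d * K ^ 2) e w ->
  (forall k : mode d K -> int, (klen k <= N.+1)%N ->
     `|kdot k (fun j => w (sqn (mode_pt j))) * h| <= pi) ->
  exact_resonance h N (fun j : mode d K => w (sqn (mode_pt j))).
Proof.
move=> e0 h0 nr phase k klenN [z hz] m.
pose p (j : mode d K) := sqn (mode_pt j).
have pL := @sqn_mode_bounds d K.
have kap0 : aggregate p k =1 (fun=> 0).
  have sk : supported (d * K ^ 2) (aggregate p k) by exact: aggregate_supported.
  apply: (coef_len0 sk); apply/eqP; rewrite -leqn0 leqNgt; apply/negP => len0.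
  have len1 : (coef_len (d * K ^ 2) (aggregate p k) <= N.+1)%N.
    by apply: leq_trans klenN; exact: aggregate_len_le.
  have := coef_dot_neq0_of_nonresonant e0 nr sk; rewrite len0 len1 => /(_ isT).
  rewrite aggregate_dot // => /negP; apply; apply/eqP.
  have := phase k klenN; rewrite mulrC hz => zpi.
  have z0 : z = 0.
    have pi0 := @pi_gt0 R.
    move: zpi; rewrite !normrM (ger0_norm (x := 2)) // (gtr0_norm pi0) -intr_norm => zpi.
    apply/eqP; rewrite -normr_le0 -ltzD1 add0r -(ltr_int R).
    rewrite -(ltr_pM2l pi0) mulr1.
    have : 0 <= pi * `|z|%:~R :> R by rewrite mulr_ge0 ?(ltW pi0) // ler0z.
    by move: zpi; clear - pi0 => *; nra.
  move: hz; rewrite z0 mulr0 => /eqP; rewrite mulf_eq0 gt_eqF //= => /eqP.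
  by [].
case: m => [n|n].
  rewrite -[RHS](kap0 n); apply: eq_bigl => j.
  by rewrite enorm_sqr -[n%:Z%:~R]/(n%:R) eqr_nat.
rewrite big_pred0 // => j; rewrite enorm_sqr; apply/negbTE.
by rewrite gt_eqF // (@lt_le_trans _ _ 0) // ltrz0.
Qed.

(** The combination is at most 3 delta, so delta <= 1 gives the bound C needed by the estimate; its
    al-th root produces the power 1/al = N/s2 of delta. *)
Lemma nonresonance_of_small_divisors (R : realType) (d K N al : nat) (h c C : R)
    (w : nat -> R) :
  (0 < al)%N -> 0 < h -> 0 < c -> 3 <= C ->
  (forall k : mode d K -> int, (klen k <= N.+1)%N ->
     `|kdot k (fun j => w (sqn (mode_pt j))) * h| <= pi) ->
  (forall kap l, supported (d * K ^ 2) kap ->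
     (0 < coef_len (d * K ^ 2) kap <= N.+1)%N ->
     `|coef_dot (d * K ^ 2) kap w| <= C -> kap l != 0 ->
     (l%:R ^+ 2 / (coef_prod (d * K ^ 2) kap)%:R) ^+ al
        <= c * `|coef_dot (d * K ^ 2) kap w|) ->
  forall s2 : R, N%:R / s2 = al%:R^-1 ->
  nonresonance h N (powR (3 * c) al%:R^-1) 1 s2 (fun j : mode d K => w (sqn (mode_pt j))).
Proof.
move=> al0 h0 c0 C3 phase est s2 s2E k klen inj delta delta1 l kl.
have [klen0 klenN] := andP klen.
pose p (j : mode d K) := sqn (mode_pt j).
have pL := @sqn_mode_bounds d K.
(* Modes on one sphere share their modified frequency, so the hypothesis on equal frequencies
   applies to them. *)
have simple j : k j != 0 -> forall i, i != j -> p i = p j -> k i = 0.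
  by move=> kj i ij pij; apply: (inj j kj i ij); rewrite -/(p i) pij.
have S3 : `|kdot k (fun j => w (p j))| <= 3 * delta.
  have := normc_expi_sub1 h0 (phase k klenN); rewrite -/delta normrM (gtr0_norm h0).
  rewrite (_ : _ * h / (3 * h) = `|kdot k (fun j => w (p j))| / 3); last first.
    by field; rewrite gt_eqF.
  by clear; lra.
have dE : coef_dot (d * K ^ 2) (aggregate p k) w = kdot k (fun j => w (p j)).
  exact: aggregate_dot.
have d0 : 0 <= delta by rewrite sqrtr_ge0.
have := est (aggregate p k) (p l) (@aggregate_supported _ p k _ pL).
rewrite (aggregate_len pL simple) klen dE => /(_ isT).
have SC : `|kdot k (fun j => w (p j))| <= C.
  by apply: le_trans S3 _; clear - delta1 C3; lra.
move=> /(_ SC (aggregate_neq0 simple kl)).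
rewrite (aggregate_prod pL simple).
have -> : enorm R (mode_pt l) ^+ 4 / \prod_j enorm R (mode_pt j) ^+ (2 * `|k j|)
    = (p l)%:R ^+ 2 / (\prod_j p j ^ `|k j|)%:R.
  rewrite (exprM _ 2 2) enorm_sqr natr_prod; congr (_ / _).
  by apply: eq_bigr => j _; rewrite exprM enorm_sqr natrX.
set X := _ / _ => XS.
have X0 : 0 <= X by rewrite divr_ge0 // exprn_ge0.
have al0R : 0 < al%:R :> R by rewrite ltr0n.
rewrite s2E -powRM //; last by rewrite mulr_ge0 // ltW.
have -> : X = powR (X ^+ al) al%:R^-1.
  by rewrite -powR_mulrn // -powRrM mulfV ?gt_eqF // powRr1.
apply: ge0_ler_powR; rewrite ?nnegrE ?invr_ge0 ?exprn_ge0 ?(ltW al0R) //.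
  by rewrite !mulr_ge0 // ltW.
apply: le_trans XS _; rewrite -mulrA mulrCA ler_pM2l //.
Qed.

Theorem theorem2p3 (R : realType) (d : nat) (lam rho0 : R) :
  (1 <= d)%N -> (lam = 1 \/ lam = -1) ->
  0 < rho0 -> 0 < 1 + 2 * lam * rho0 ^+ 2 ->
  exists c1 C2 : R, [/\ 0 < c1, 0 < C2 &
  forall (h0 : R) (N : nat) (gamma : R),
    0 < h0 -> (2 <= N)%N -> 0 < gamma ->
    exists2 c2 : R, 0 < c2 &
    exists P : set (R * R),
      [/\ measurable P,
          P `<=` `[0, rho0] `*` `[0, h0],
          ((rho0 * h0 - gamma)%:E <=
             (@lebesgue_measure R \x @lebesgue_measure R) P)%E &
          forall rho h : R, P (rho, h) -> 0 < h ->
          forall K : nat, (1 <= K)%N ->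
            d%:R * h * K%:R ^+ 2 + 2 * h * rho0 ^+ 2 <= pi / N.+1%:R ->
            assumption1 d lam h rho K c1 /\
            assumption2 d lam h rho K N (C2 * h ^+ 2) c2 1
              (5 ^+ 4 * N%:R ^+ 5)]].
Proof.
move=> _ lamE rho00 lamrho.
have lam1 : `|lam| = 1 by case: lamE => ->; rewrite ?normrN normr1.
pose B := rho0 ^+ 2; have B0 : 0 <= B by rewrite sqr_ge0.
(* A lower bound for 1 + 2 mu valid for both signs of lam and all rho up to rho0. *)
pose k := Num.min 1 (1 + 2 * lam * B).
have kbnd : 0 < k <= 1 by rewrite lt_min ltr01 lamrho ge_min lexx.
have k0 : 0 < k by case/andP: kbnd.
have disp sig : 0 <= sig <= rho0 ^+ 2 -> k <= 1 + 2 * (lam * sig).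
  move=> /andP[s0 s1]; rewrite ge_min; case: lamE => ->.
    by apply/orP; left; clear - s0; lra.
  by apply/orP; right; move: s1; rewrite -/B; clear; lra.
have [C2 C20 approx] := mod_freq_approx B0 kbnd.
exists (k / 12), C2; split => //; first by rewrite divr_gt0.
move=> h0 N gamma h00 N2 gamma0.
have Cw0 : 0 <= 3 * B ^+ 2 by apply: mulr_ge0 => //; exact: sqr_ge0.
pose G := B + 3 * B ^+ 2; have G0 : 0 <= G by exact: addr_ge0.
have NG0 : 0 <= N%:R * (1 + G) + 1 by rewrite addr_ge0 // mulr_ge0 // addr_ge0.
pose Cp := Num.bound (N%:R * (1 + G) + 1).
have CpP : N%:R * (1 + G) + 1 <= Cp%:R by apply/ltW/archi_boundP.
have [e ebnd [P [mP Psub Pmes Pnr]]] :=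
  nonresonant_set N Cp lam1 rho00 kbnd disp h00 gamma0.
have e0 : 0 < e by case/andP: ebnd.
(* [res_exp N] equals 3N^2 + 17N + 20, at most 25 N^2 for N >= 2; [al] is the square of this bound
   and s2 = N al. *)
pose al := (5 ^ 4 * N ^ 4)%N.
have al0 : (0 < al)%N by rewrite muln_gt0 !expn_gt0 (ltn_trans _ N2).
have resal : (res_exp N * res_exp N <= al)%N.
  have h1 : (res_exp N <= 25 * N ^ 2)%N by rewrite /res_exp; clear - N2; nia.
  apply: leq_trans (leq_mul h1 h1) _.
  by rewrite /al leq_eqVlt; apply/orP; left; apply/eqP; clear; lia.
have res0 : (0 < res_exp N)%N by rewrite /res_exp addn_gt0 addnS.
have [c c0 est] :=
  small_divisor_estimate G0 Cw0 (ler0n R 3) ebnd res0 resal CpP.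
exists (powR (3 * c) al%:R^-1); first by rewrite powR_gt0 // mulr_gt0.
exists P; split => // rho h Ph h0' K K1 cfl.
pose mu := lam * rho ^+ 2; pose L := (d * K ^ 2)%N.
have /andP[rho_ge0 rho_le] : 0 <= rho <= rho0.
  by have [/= + _] := Psub _ Ph; rewrite in_itv.
have rhoB : 0 <= rho ^+ 2 <= rho0 ^+ 2.
  by rewrite sqr_ge0 lerXn2r // nnegrE // ltW.
have kmu : k <= 1 + 2 * mu by apply: disp.
have muB : `|mu| <= B.
  by rewrite /mu normrM lam1 mul1r ger0_norm ?sqr_ge0 //; case/andP: rhoB.
(* As N + 1 >= 3, the CFL condition puts n h and 2 h B below pi/3, the range of all trigonometric
   estimates. *)
have N13 : 3 <= N.+1%:R :> R by rewrite (ler_nat R 3).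
have piN : pi / N.+1%:R <= pi / 3 :> R.
  by rewrite ler_pM2l ?pi_gt0 // lef_pV2 // posrE.
have LE : L%:R * h = d%:R * h * K%:R ^+ 2 by rewrite /L natrM natrX; ring.
have hB0 : 0 <= 2 * h * rho0 ^+ 2 by rewrite !mulr_ge0 // ltW.
have Lh0 : 0 <= L%:R * h by rewrite mulr_ge0 // ltW.
have Lh3 : L%:R * h <= pi / 3 by rewrite LE; apply: le_trans piN; apply: le_trans cfl; rewrite lerDl.
have hB3 : 2 * h * B <= pi / 3 by apply: le_trans piN; apply: le_trans cfl; rewrite lerDr -LE.
have nh3 n : (n <= L)%N -> n%:R * h <= pi / 3.
  move=> nL; apply: le_trans Lh3; rewrite ler_pM2r // ler_nat //.
have modeL (j : mode d K) : (0 < sqn (mode_pt j))%N /\ (sqn (mode_pt j))%:R * h <= pi / 3.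
  by have /andP[-> jL] := sqn_mode_bounds j; split => //; exact: nh3.
split.
  move=> j; rewrite /= enorm_sqr -(mulrA h); have [j0 jh] := modeL j.
  exact: (stability_gap j0 kbnd kmu muB h0' jh hB3).
pose w n := mod_freq n mu h.
have wscaled n : (0 < n <= L)%N -> 0 <= h * w n <= pi / N.+1%:R.
  move=> /andP[n0 nL].
  have /andP[w0 w1] := mod_freq_scaled_le n0 kbnd kmu muB h0' (nh3 _ nL) hB3.
  rewrite w0 /=; apply: le_trans w1 _; apply: le_trans cfl; rewrite lerD2r -LE.
  by rewrite ler_pM2r // ler_nat.
have phase (q : mode d K -> int) : (klen q <= N.+1)%N ->
    `|kdot q (fun j => w (sqn (mode_pt j))) * h| <= pi.
  move=> qN; have piN0 : 0 <= pi / N.+1%:R :> R by rewrite divr_ge0 // pi_ge0.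
  have := mode_dot_phase_le qN piN0 wscaled.
  by rewrite [X in _ <= X]mulrC divfK // pnatr_eq0.
have wmu n : (0 < n <= L)%N -> `|w n - n%:R - mu| <= 3 * B ^+ 2 / n%:R.
  by move=> /andP[n0 nL]; apply: mod_freq_asymptotics kbnd kmu muB h0' (nh3 _ nL).
have wG n : (0 < n <= L)%N -> `|w n - n%:R| <= G.
  move=> nL; have := wmu _ nL; case/andP: nL => n0 _ h1.
  have -> : w n - n%:R = (w n - n%:R - mu) + mu by rewrite subrK.
  apply: le_trans (ler_normD _ _) _; rewrite /G addrC lerD //.
  apply: le_trans h1 _; rewrite ler_pdivrMr ?ltr0n // ler_peMr // ler1n //.
have nr := Pnr _ _ Ph L; rewrite -/mu in nr.
exists (fun j => w (sqn (mode_pt j))); split.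
- move=> j; have [j0 jh] := modeL j; rewrite /frequency /= enorm_sqr -(mulrA h).
  rewrite gtr0_sg; last by exact: (frequency_sign j0 kbnd kmu h0' jh).
  by rewrite mulr1; apply: approx.
- apply: (@nonresonance_of_small_divisors R d K N al h c 3 w) => //.
    move=> kap l sk klen SC kl.
    exact: (est L w mu kap l wG wmu nr sk klen SC kl).
  rewrite /al natrM !natrX; field.
  by rewrite pnatr_eq0 -lt0n (ltn_trans _ N2).
- exact: (exact_resonance_of_nonresonant e0 h0' nr phase).
Qed.
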